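(* Let $A$ be a nontrivial finite abelian group, and let $B$ be an infinite finitely generated abelian group. If the torsion free rank of $B$ is $1$, then $$\mathrm{Conj}_{A \wr B}(n) \approx 2^{n}.$$ If the torsion free rank of $B$ is $k \geq 2$, then $$2^{n} \preceq \mathrm{Conj}_{A \wr B}(n) \preceq 2^{n^{2k}}.$$
   Context: The torsion free rank of a finitely generated abelian group $B$ is the natural number $k$ with $B \cong \mathbb{Z}^k \oplus \mathrm{Tor}(B)$, where $\mathrm{Tor}(B)$ is the subgroup of elements of finite order. $A \wr B = \left(\bigoplus_{b \in B} A\right) \rtimes B$ is the restricted wreath product, with $B$ acting by translation of the coordinates. Let $G$ be a finitely generated group with finite generating set $S$; $\mathrm{B}_{G,S}(n)$ is the ball of radius $n$ around the identity in the word length of $S$. Write $\sim_G$ for conjugacy in $G$. For $f \not\sim_G g$ put $\mathrm{CD}_G(f,g) = \min\{|G/N| : N \trianglelefteq G \text{ of finite index and } fN \not\sim_{G/N} gN\}$, with value $\infty$ if no such $N$ exists. $G$ is conjugacy separable if $\mathrm{CD}_G(f,g)<\infty$ for all non-conjugate $f,g\in G$. For conjugacy separable $G$, the conjugacy separability depth function is $\mathrm{Conj}_{G,S}(n) = \max\{\mathrm{CD}_G(f,g) : f,g \in \mathrm{B}_{G,S}(n),\ f \not\sim_G g\}$. For non-decreasing functions $f,g$ on $\mathbb{N}$, write $f \preceq g$ if there is $C \in \mathbb{N}$ with $f(n) \leq C g(Cn)$ for all $n \in \mathbb{N}$, and $f \approx g$ if $f \preceq g$ and $g \preceq f$. Up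 to $\approx$, $\mathrm{Conj}_{G,S}$ does not depend on the finite generating set $S$, so $S$ is suppressed. *)

(* Defs.v *)
From HB Require Import structures.
From mathcomp Require Import all_boot all_order all_algebra finmap.
From mathcomp Require Import boolp classical_sets cardinality.
From mathcomp.multinomials Require Import monalg.

Set Implicit Arguments.
Unset Strict Implicit.
Unset Printing Implicit Defensive.

Import GRing.Theory.

Section FinitelyGenerated.
Variable G : groupType.
Implicit Types (S : seq G) (x : G) (n : nat).
Local Open Scope group_scope.

(* [word_ball S n] lists, possibly with repetitions, the products of at most n
   letters taken in S and the inverses of S. *)
Fixpoint word_ball S n : seq G :=
  if n is m.+1
  then word_ball S m ++
       [seq x * s | x <- word_ball S m, s <- S ++ [seq t^-1 | t <- S]]
  else [:: 1].

Definition generating S : Prop := forall x, exists n, x \in word_ball S n.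

Definition finitely_generated : Prop := exists S, generating S.

End FinitelyGenerated.

Section ConjugacySeparability.
Variable G : groupType.
Implicit Types (f g : G) (N : set G) (S : seq G) (n m : nat).
Local Open Scope group_scope.
Local Open Scope classical_set_scope.
Local Open Scope card_scope.

Definition are_conjugate f g : Prop := exists h, f ^ h = g.

Definition normal_subgroup N : Prop :=
  [/\ N 1, forall x y, N x -> N y -> N (x / y) & forall x y, N x -> N (x ^ y)].

Definition left_coset N f : set G := [set f * x | x in N].

Definition left_cosets N : set (set G) := range (left_coset N).

(* For N normal, fN and gN are conjugate in G / N: (hN)^-1 (fN) (hN) = gN. *)
Definition are_conjugate_mod N f g : Prop :=
  exists h, left_coset N (f ^ h) = left_coset N g.

Definition separated_in_order f g : pred nat := fun m =>
  `[< exists N, [/\ normal_subgroup N, left_cosets N #= `I_m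
                  & ~ are_conjugate_mod N f g] >].

(* [None] stands for the value infinity. *)
Definition CD f g : option nat :=
  if pselect (exists m, separated_in_order f g m) is left ex
  then Some (ex_minn ex) else None.

Definition conjugacy_separable : Prop :=
  forall f g, ~ are_conjugate f g -> CD f g <> None.

(* Meaningful for conjugacy separable G, where the default of [odflt] is never
   used.  The maximum of the empty set, which occurs for n = 0, is 0. *)
Definition Conj S n : nat :=
  \max_(f <- word_ball S n)
     \max_(g <- word_ball S n | ~~ `[< are_conjugate f g >])
        odflt 0%N (CD f g).

End ConjugacySeparability.

(* Here the natural numbers n and C are positive: the ball of radius 0 contains
   no pair of non-conjugate elements. *)
Definition asym_le (f g : nat -> nat) : Prop :=
  exists2 C, 0 < C & forall n, 0 < n -> f n <= C * g (C * n).

Definition asym_eq (f g : nat -> nat) : Prop := asym_le f g /\ asym_le g f.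

Section TorsionFreeRank.
Variable B : zmodType.
Local Open Scope ring_scope.

Definition torsion : {pred B} :=
  [pred b | `[< exists2 n, (0 < n)%N & b *+ n = 0 >]].

Lemma torsion_zmod_closed : zmod_closed torsion.
Proof.
split=> [|x y]; first by apply/asboolP; exists 1%N.
move=> /asboolP[m m0 xm] /asboolP[n n0 yn].
apply/asboolP; exists (m * n)%N; first by rewrite muln_gt0 m0.
by rewrite mulrnBl mulrnA xm mul0rn mulnC mulrnA yn mul0rn subr0.
Qed.

HB.instance Definition _ :=
  GRing.isZmodClosed.Build B torsion torsion_zmod_closed.

Record Tor := MkTor { Tor_val :> B; _ : Tor_val \in torsion }.

HB.instance Definition _ := [isSub for Tor_val].
HB.instance Definition _ := [Choice of Tor by <:].
HB.instance Definition _ := [SubChoice_isSubZmodule of Tor by <:].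

Definition torsion_free_rank (k : nat) : Prop :=
  exists phi : {additive B -> ('rV[int]_k * Tor)%type}, bijective phi.

End TorsionFreeRank.

Section WreathProduct.
Variables (A B : zmodType).
Local Open Scope fset_scope.
Local Open Scope ring_scope.

(* Only the additive group of [{malg A[B]}] is used: it is the direct sum of
   copies of A indexed by B, i.e. the finitely supported functions B -> A.
   The element b of B translates the coordinates by b. *)
Definition translate (b : B) (u : {malg A[B]}) : {malg A[B]} :=
  [malg x in [fset b + y | y in msupp u] => u@_(x - b)].

Lemma translateE b u x : (translate b u)@_x = u@_(x - b).
Proof.
rewrite mcoeffE; case: ifPn => // xNi; apply/esym/mcoeff_outdom.
apply: contra xNi => xi; apply/imfsetP; exists (x - b) => //=.
by rewrite addrC subrK.
Qed.

Lemma translateD b u v : translate b (u + v) = translate b u + translate b v.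
Proof. by apply/malgP => x; rewrite mcoeffD !translateE mcoeffD. Qed.

Lemma translateN b u : translate b (- u) = - translate b u.
Proof. by apply/malgP => x; rewrite mcoeffN !translateE mcoeffN. Qed.

Lemma translate0 u : translate 0 u = u.
Proof. by apply/malgP => x; rewrite translateE subr0. Qed.

Lemma translateA b c u : translate b (translate c u) = translate (b + c) u.
Proof. by apply/malgP => x; rewrite !translateE opprD addrA. Qed.

Record wreath := Wreath { lamps : {malg A[B]}; cursor : B }.

Definition wreath_pair w := (lamps w, cursor w).
Definition wreath_of_pair p := Wreath p.1 p.2.

Lemma wreath_pairK : cancel wreath_pair wreath_of_pair.
Proof. by case. Qed.

HB.instance Definition _ := Choice.copy wreath (can_type wreath_pairK).

Definition wreath_one : wreath := Wreath 0 0.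

Definition wreath_mul (w z : wreath) : wreath :=
  Wreath (lamps w + translate (cursor w) (lamps z)) (cursor w + cursor z).

Definition wreath_inv (w : wreath) : wreath :=
  Wreath (translate (- cursor w) (- lamps w)) (- cursor w).

Lemma wreath_mulA : associative wreath_mul.
Proof.
by move=> [u a] [v b] [w c]; rewrite /wreath_mul /= translateD translateA !addrA.
Qed.

Lemma wreath_mul1w : left_id wreath_one wreath_mul.
Proof. by move=> [u a]; rewrite /wreath_mul /= translate0 !add0r. Qed.

Lemma wreath_mulw1 : right_id wreath_one wreath_mul.
Proof.
move=> [u a]; rewrite /wreath_mul /= addr0; congr Wreath.
by apply/malgP => x; rewrite mcoeffD translateE mcoeff0 addr0.
Qed.

Lemma wreath_mulVw : left_inverse wreath_one wreath_inv wreath_mul.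
Proof. by move=> [u a]; rewrite /wreath_mul /= translateN !addNr. Qed.

Lemma wreath_mulwV : right_inverse wreath_one wreath_inv wreath_mul.
Proof.
by move=> [u a]; rewrite /wreath_mul /= translateA subrr translate0 subrr.
Qed.

HB.instance Definition _ := isGroup.Build wreath
  wreath_mulA wreath_mul1w wreath_mulw1 wreath_mulVw wreath_mulwV.

End WreathProduct.

(* Main.v *)
(* Summing the lamps over the cosets of a subgroup of B ("folding") shows that
   (u, b) and (u', b') are conjugate in A wr B iff b = b' and the folds of u and
   u' along <b> are translates of each other.

   Upper bounds.  The quotient A wr (B / mB), of order |A|^r r with r = |B /
     mB|,
   separates (u, b) from (u', b) as soon as mB + <b> meets a suitable finite set
   K, made of differences of points of the supports, only in <b>.  Suppose that
   e kills the torsion of B, that the length of the elements is n, and that some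
   coordinate b_i in Z^k of b is nonzero.  Then any multiple m of e b_i larger
   than a constant times n^2 will do: x in K and mB + <b> satisfies
   x_i b_j - x_j b_i = 0 mod m, hence x_i b_j = x_j b_i.  For k = 1 this
   congruence is void, so m = e |b_i|, which is linear in n, suffices.

   Lower bound.  Let t in B have infinite order, a in A have prime order p, and
   m = p^s.  Then (0, mt) is not conjugate to (sum_(i < m) a X^i, mt), where
   X stands for the translation by t.  Modulo X^m - 1 the lamps a q(X) form
   F_p[X] / (X - 1)^m, in which every nonzero ideal contains
   (X - 1)^(m-1) = sum_(i < m) X^i.  So a finite quotient which separates the
   two elements is injective on the p^m elements a q(X), deg q < m. *)

From HB Require Import structures.
Require Import Defs.
From mathcomp Require Import all_boot all_order all_algebra.
From mathcomp Require Import boolp classical_sets cardinality.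
From mathcomp Require Import finmap zify ring.
From mathcomp.multinomials Require Import monalg.

Set Implicit Arguments.
Unset Strict Implicit.
Unset Printing Implicit Defensive.

Import GRing.Theory Num.Theory.

(** * Word balls and depth of separation *)

Section WordBall.
Variable G : groupType.
Implicit Types (S : seq G) (x y : G) (n m : nat).
Local Open Scope group_scope.

Lemma word_ballS S n x : x \in word_ball S n -> x \in word_ball S n.+1.
Proof. by move=> xn; rewrite /= mem_cat xn. Qed.

Lemma word_ball_letter S n x s : x \in word_ball S n ->
  s \in S ++ [seq t^-1 | t <- S] -> x * s \in word_ball S n.+1.
Proof.
by move=> xn sS; rewrite /= mem_cat; apply/orP; right; apply/allpairsP;
  exists (x, s).
Qed.

Lemma word_ball_ind S (P : nat -> G -> Prop) :
  (forall n, P n 1) ->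
  (forall n x s, P n x -> s \in S ++ [seq t^-1 | t <- S] -> P n.+1 (x * s)) ->
  (forall n x, P n x -> P n.+1 x) ->
  forall n x, x \in word_ball S n -> P n x.
Proof.
move=> P1 PM PS; elim=> [|n IHn] x /=; first by rewrite inE => /eqP->.
rewrite mem_cat => /orP[/IHn/PS //|/allpairsP[[y s] /= [yn sS ->]]].
by apply: PM => //; apply: IHn.
Qed.

Lemma word_ball_le S n m x : n <= m ->
  x \in word_ball S n -> x \in word_ball S m.
Proof.
move/subnKC=> <-; elim: (m - n)%N => [|d IHd] xn; first by rewrite addn0.
by rewrite addnS; apply/word_ballS/IHd.
Qed.

Lemma word_ball1 S n : 1 \in word_ball S n.
Proof. by apply: (@word_ball_le S 0) => //; rewrite /= inE. Qed.

Lemma word_ballM S n m x y :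
  x \in word_ball S n -> y \in word_ball S m -> x * y \in word_ball S (n + m).
Proof.
move=> xn; move: m y; apply: word_ball_ind => [m|m y s xyn sS|m y].
- by rewrite mulg1; apply: word_ball_le xn; apply: leq_addr.
- by rewrite mulgA addnS word_ball_letter.
- by rewrite addnS; apply: word_ballS.
Qed.

Lemma word_ballX S n x k :
  x \in word_ball S n -> x ^+ k \in word_ball S (k * n).
Proof.
move=> xn; elim: k => [|k IHk]; first exact: word_ball1.
by rewrite expgS mulSn word_ballM.
Qed.

Lemma word_ballV S n x : x \in word_ball S n -> x^-1 \in word_ball S n.
Proof.
move: n x; apply: word_ball_ind => [n|n x s xn sS|n x];
  first by rewrite invg1 word_ball1.
  rewrite invgM -add1n word_ballM //; rewrite -[s^-1]mul1g word_ball_letter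
    ?word_ball1 //.
  move: sS; rewrite !mem_cat => /orP[sS|/mapP[t tS ->]].
    by rewrite map_f ?orbT.
  by rewrite invgK tS.
exact: word_ballS.
Qed.

Lemma word_ball_mem S s : s \in S -> s \in word_ball S 1.
Proof.
by move=> sS; rewrite -[s]mul1g word_ball_letter ?word_ball1 // mem_cat sS.
Qed.

End WordBall.

(** * Counting the cosets of a normal subgroup *)

Section Cosets.
Variable G : groupType.
Implicit Types (f g : G) (N : set G) (n m : nat).
Local Open Scope group_scope.
Local Open Scope classical_set_scope.
Local Open Scope card_scope.

Lemma normal_subgroupV N x : normal_subgroup N -> N x -> N x^-1.
Proof. by case=> N1 NB _ Nx; have := NB _ _ N1 Nx; rewrite div1g. Qed.

Lemma normal_subgroupM N x y : normal_subgroup N -> N x -> N y -> N (x * y).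
Proof.
move=> nN Nx Ny; case: (nN) => _ NB _.
by rewrite -[y]invgK; apply: NB => //; apply: normal_subgroupV.
Qed.

Lemma left_cosetP N f g : normal_subgroup N ->
  left_coset N f = left_coset N g <-> N (f^-1 * g).
Proof.
move=> nN; split=> [fg|Nfg].
  have : left_coset N f g by rewrite fg; exists 1; [case: nN|rewrite mulg1].
  by case=> x Nx <-; rewrite mulKg.
apply/seteqP; split=> _ [x Nx <-].
  exists ((f^-1 * g)^-1 * x); last by rewrite invgM invgK !mulgA mulgV mul1g.
  by apply: normal_subgroupM => //; apply: normal_subgroupV.
by exists (f^-1 * g * x); [apply: normal_subgroupM|rewrite !mulgA mulgV mul1g].
Qed.

Lemma card_setT_finType (F : finType) : [set: F] #= `I_#|F|.
Proof.
apply: (card_eq_trans _ (card_esym card_II)).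
have rank_inj : {in [set: F] &, injective (enum_rank : F -> _)}.
  by move=> x y _ _; apply: enum_rank_inj.
apply: card_eq_trans (card_esym (inj_card_eq rank_inj)) _.
suff -> : enum_rank @` [set: F] = [set: 'I_#|F|] by apply: card_eqxx.
by apply/seteqP; split=> // i _; exists (enum_val i) => //; apply: enum_valK.
Qed.

(** Choosing one element of each colour reaches every coset. Colours that [tau] does not take get
    the default representative 1, which is harmless for a surjection. *)
Lemma left_cosets_card_le (F : finType) (tau : G -> F) N :
  (forall f g, tau f = tau g -> left_coset N f = left_coset N g) ->
  exists2 c, left_cosets N #= `I_c & c <= #|F|.
Proof.
move=> tauN; pose rep t := xget (1 : G) [set f | tau f = t].
have le : left_cosets N #<= [set: F].
  apply: card_le_trans (card_image_le (fun t => left_coset N (rep t)) _).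
  apply: subset_card_le => _ [f _ <-]; exists (tau f) => //.
  by apply: tauN; rewrite /rep; apply: (@xgetPex _ 1 [set h | tau h = tau f]);
    exists f.
have {}le : left_cosets N #<= `I_#|F| by rewrite -(card_le_eqr
  (card_setT_finType F)).
have /finite_setP[c Nc] : finite_set (left_cosets N) by apply: card_le_finite
  le _.
by exists c => //; rewrite -card_le_II -(card_le_eql Nc).
Qed.

Lemma left_cosets_card_ge (F : finType) (tau : F -> G) N c :
  (forall x y, left_coset N (tau x) = left_coset N (tau y) -> x = y) ->
  left_cosets N #= `I_c -> #|F| <= c.
Proof.
move=> tauN Nc; rewrite -card_le_II -(card_le_eqr Nc).
rewrite -(card_le_eql (card_setT_finType F)).
have tau_inj : {in [set: F] &, injective (fun x => left_coset N (tau x))}.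
  by move=> x y _ _; apply: tauN.
rewrite -(card_le_eql (inj_card_eq tau_inj)).
by apply: subset_card_le => _ [x _ <-]; exists (tau x).
Qed.

Lemma CD_le f g m : separated_in_order f g m ->
  exists2 d, CD f g = Some d & d <= m.
Proof.
move=> fgm; rewrite /CD; case: pselect => [ex|]; last by case; exists m.
by exists (ex_minn ex) => //; case: ex_minnP => d _; apply.
Qed.

Lemma CD_separated f g d : CD f g = Some d -> separated_in_order f g d.
Proof.
by rewrite /CD; case: pselect => // ex [<-]; case: ex_minnP.
Qed.

Lemma Conj_le S n b :
  (forall f g, f \in word_ball S n -> g \in word_ball S n -> ~ are_conjugate f
    g ->
     exists2 d, CD f g = Some d & d <= b) ->
  Conj S n <= b.
Proof.
move=> CDb; apply/bigmax_leqP_seq => f fn _;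
  apply/bigmax_leqP_seq => g gn /asboolPn fg.
by have [d -> /=] := CDb f g fn gn fg.
Qed.

Lemma Conj_ge S n f g d : f \in word_ball S n -> g \in word_ball S n ->
  ~ are_conjugate f g -> CD f g = Some d -> d <= Conj S n.
Proof.
move=> fn gn /asboolPn fg CDfg.
rewrite /Conj; apply: leq_trans (leq_bigmax_seq f fn isT).
by apply: leq_trans (leq_bigmax_seq g gn fg); rewrite CDfg.
Qed.

End Cosets.

(** * Folding along a subgroup *)

Section MultipleSpan.
Variable B : zmodType.
Implicit Types (b x y : B) (m : nat).
Local Open Scope ring_scope.

(* mB + <b>; it is mB for b = 0 and <b> for m = 0. *)
Definition mulspan m b : {pred B} :=
  [pred x | `[< exists y (j : int), x = y *+ m + b *~ j >] ].

Lemma mulspanP m b x :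
  reflect (exists y (j : int), x = y *+ m + b *~ j) (x \in mulspan m b).
Proof. exact: asboolP. Qed.

Lemma mulspan_zmod_closed m b : zmod_closed (mulspan m b).
Proof.
split=> [|x1 x2]; first by apply/mulspanP; exists 0, 0;
  rewrite mul0rn mulr0z addr0.
move=> /mulspanP[y1 [j1 ->]] /mulspanP[y2 [j2 ->]].
by apply/mulspanP; exists (y1 - y2), (j1 - j2);
  rewrite mulrnBl mulrzBr addrACA opprD.
Qed.

HB.instance Definition _ m b :=
  GRing.isZmodClosed.Build B (mulspan m b) (mulspan_zmod_closed m b).

Lemma mulspanMn m b x : x *+ m \in mulspan m b.
Proof. by apply/mulspanP; exists x, 0; rewrite mulr0z addr0. Qed.

Lemma mulspanMz m b (j : int) : b *~ j \in mulspan m b.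
Proof. by apply/mulspanP; exists 0, j; rewrite mul0rn add0r. Qed.

Lemma mulspan_gen m b : b \in mulspan m b.
Proof. by rewrite -[X in X \in _]mulr1z mulspanMz. Qed.

Lemma mulspan0P b x : reflect (exists j : int, x = b *~ j) (x \in mulspan 0 b).
Proof.
apply: (iffP idP) => [/mulspanP[y [j ->]]|[j ->]]; last exact: mulspanMz.
by exists j; rewrite add0r.
Qed.

Lemma mulspanMP m x : reflect (exists y, x = y *+ m) (x \in mulspan m 0).
Proof.
apply: (iffP (mulspanP _ _ _)) => [[y [j ->]]|[y ->]]; exists y.
  by rewrite mul0rz addr0.
by exists 0; rewrite mulr0z addr0.
Qed.

Lemma mulspanS m b x : x \in mulspan m 0 -> x \in mulspan m b.
Proof.
move=> /mulspanP[y [j ->]]; rewrite mul0rz addr0; exact: mulspanMn.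
Qed.

Lemma mulspan0S m b x : x \in mulspan 0 b -> x \in mulspan m b.
Proof. by move=> /mulspan0P[j ->]; exact: mulspanMz. Qed.

End MultipleSpan.

Section Lamps.
Variables A B : zmodType.
Implicit Types (u v w : {malg A[B]}) (a : A) (b c x y z : B) (M : zmodClosed B).
Local Open Scope ring_scope.

Lemma malg_ind (P : {malg A[B]} -> Prop) :
  P 0 -> (forall a x u, P u -> P (<< a *g x >> + u)) -> forall u, P u.
Proof.
by move=> P0 PU u; rewrite [u]monalgE; apply: big_rec => // x v _; apply: PU.
Qed.

Lemma translateU c a x : translate c << a *g x >> = << a *g c + x >>.
Proof.
apply/malgP => y; rewrite translateE !mcoeffU; congr (_ *+ nat_of_bool _).
by apply/eqP/eqP => [->|<-]; [rewrite addrC subrK|rewrite addrC addKr].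
Qed.

Lemma translate_zmod c : zmod_morphism (@translate A B c).
Proof. by move=> u v; rewrite translateD translateN. Qed.

HB.instance Definition _ c :=
  GRing.isZmodMorphism.Build _ _ (@translate A B c) (translate_zmod c).

Lemma mem_msupp_translate c u x :
  (x \in msupp (translate c u)) = (x - c \in msupp u).
Proof. by rewrite -!mcoeff_neq0 translateE. Qed.

Definition msum (P : pred B) u : A := \sum_(y <- msupp u | P y) u@_y.

Lemma msumEw P (D : {fset B}) u : (msupp u `<=` D)%fset ->
  msum P u = \sum_(y <- D | P y) u@_y.
Proof.
move=> uD; rewrite /msum big_mkcond [RHS]big_mkcond.
apply: big_fset_incl => // x xD xu; case: ifP => // _.
exact: mcoeff_outdom.
Qed.

Lemma msum_zmod P : zmod_morphism (msum P).
Proof.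
move=> u v; pose D := (msupp u `|` msupp v)%fset.
rewrite (@msumEw _ D) ?msuppB_le // (@msumEw _ D u) ?fsubsetUl //.
rewrite (@msumEw _ D v) ?fsubsetUr // -sumrB.
by apply: eq_bigr => y _; rewrite mcoeffB.
Qed.

HB.instance Definition _ P :=
  GRing.isZmodMorphism.Build _ _ (msum P) (msum_zmod P).

Lemma msumU P a x : msum P << a *g x >> = a *+ P x.
Proof.
rewrite (@msumEw _ [fset x]%fset) ?msuppU_le //= big_mkcond /= big_seq_fset1.
by rewrite mcoeffUU; case: (P x).
Qed.

Lemma msum_translate P c u :
  msum P (translate c u) = msum (fun y => P (c + y)) u.
Proof.
elim/malg_ind: u => [|a x u IHu]; first by rewrite !raddf0.
by rewrite !raddfD /= IHu translateU !msumU.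
Qed.

Lemma eq_msum P Q u : P =1 Q -> msum P u = msum Q u.
Proof. by move=> PQ; apply: eq_bigl. Qed.

(* The image of u in A[B / M], viewed as an M-periodic function on B. *)
Definition fold (M : {pred B}) u x : A := msum (fun y => y - x \in M) u.

Lemma fold_translate M c u x : fold M (translate c u) x = fold M u (x - c).
Proof.
by rewrite /fold msum_translate; apply: eq_msum => y;
  rewrite opprB addrCA addrA.
Qed.

Lemma foldB M u v x : fold M (u - v) x = fold M u x - fold M v x.
Proof. exact: raddfB. Qed.

Lemma foldD M u v x : fold M (u + v) x = fold M u x + fold M v x.
Proof. exact: raddfD. Qed.

Lemma foldN M u x : fold M (- u) x = - fold M u x.
Proof. exact: raddfN. Qed.

Lemma fold0 M x : fold M 0 x = 0.
Proof. exact: raddf0. Qed.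

Lemma fold_eq M u x y : x - y \in M -> fold M u x = fold M u y.
Proof.
move=> xyM; apply: eq_msum => z.
by rewrite -[in RHS](subrK x z) -addrA (rpredDr _ xyM).
Qed.

Lemma fold_supp M u x :
  fold M u x != 0 -> exists2 y, y \in msupp u & y - x \in M.
Proof.
case: (pselect (exists2 y, y \in msupp u & y - x \in M)) => // noy.
rewrite /fold /msum big_seq_cond big_pred0 ?eqxx // => y.
by apply/negP => /andP[yu yM]; apply: noy; exists y.
Qed.

(** Around a point [y] of the support of [w], the cosets y + M and y + N contain the same points of
    the support, so both folds at [y] are the same sum. *)
Lemma fold_sub (M N : zmodClosed B) w :
  {subset N <= M} ->
  (forall y z, y \in msupp w -> z \in msupp w -> y - z \in M -> y - z \in N) ->
  (forall x, fold M w x = 0) -> forall x, fold N w x = 0.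
Proof.
move=> NM wMN w0 x; apply/eqP/negPn/negP => wx; case: (fold_supp wx) => y yw yx.
case/eqP: wx; rewrite -(fold_eq _ yx) -[RHS](w0 y).
rewrite /fold /msum big_seq_cond [RHS]big_seq_cond; apply: eq_bigl => z.
case zw: (z \in msupp w) => //=; apply/idP/idP; [exact: NM|exact: wMN].
Qed.

(** Equal lamps placed along x, x + b, x + 2b, ... telescope under T_b - 1, where T_b is the
    translation by [b]. *)
Lemma coboundaryU b a x y : y - x \in mulspan 0 b ->
  exists v, << a *g y >> - << a *g x >> = translate b v - v.
Proof.
have nat_case n z : exists v, << a *g z + b *+ n >> - << a *g z >> = translate
  b v - v.
  elim: n => [|n [v IHn]]; first by exists 0;
    rewrite mulr0n addr0 subrr raddf0 subr0.
  exists (v + << a *g z + b *+ n >>).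
  rewrite translateD translateU opprD addrACA -IHn [RHS]addrC addrA subrK.
  by rewrite mulrS addrCA.
move=> /mulspan0P[j /(canRL (subrK _))]; rewrite addrC => ->;
  case: (intP j) => [|n|n].
- by rewrite mulr0z addr0; have := nat_case 0%N x; rewrite mulr0n addr0.
- exact: nat_case.
(* For a negative multiple the telescoping starts from the other end, y = x - (n + 1)b, and the sign
   of [v] is reversed. *)
- have [v ev] := nat_case n.+1 (x + b *~ - n.+1%:Z).
  exists (- v); rewrite translateN -opprD -ev opprB; congr (_ - << _ *g _ >>).
  by rewrite mulrNz -pmulrn subrK.
Qed.

(* Moving each lamp to a chosen representative of its coset changes u by an
   element of J and, all the folds being 0, leaves nothing. *)
Lemma fold_eq0_ind M (J : {malg A[B]} -> Prop) u :
  J 0 -> (forall v w, J v -> J w -> J (v - w)) ->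
  (forall a x y, y - x \in M -> J (<< a *g y >> - << a *g x >>)) ->
  (forall x, fold M u x = 0) -> J u.
Proof.
move=> J0 JB JM u0.
have JD v w : J v -> J w -> J (v + w).
  by move=> Jv Jw; rewrite -[w]opprK -[- w]sub0r; apply: (JB) => //; apply: JB.
(* As [x] lies in its own coset, the value of [choose] depends only on that coset. *)
pose r x := choose (fun y => y - x \in M) x.
have rP x : r x - x \in M.
  by apply: (@chooseP _ (fun y => y - x \in M)); rewrite subrr rpred0.
have r_eq x y : (r x == r y) = (x - y \in M).
  apply/eqP/idP => [rxy|xy].
    by have := rP y; rewrite -rxy -[r x](subrK x) -addrA (rpredDl _ (rP x)).
  rewrite /r (@eq_choose _ _ (fun z => z - y \in M)).
    by apply: choose_id; rewrite ?subrr ?rpred0.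
  by move=> z; rewrite -[in RHS](subrK x z) -addrA (rpredDr _ xy).
have [v Juv ev] : exists2 v, J (u - v) & forall z, v@_z = msum (fun y => r y ==
  z) u.
  elim/malg_ind: u {u0} => [|a x u [v Juv IHv]].
    by exists 0 => [|z]; rewrite ?subr0 // mcoeff0 (raddf0 (msum _)).
  exists (<< a *g r x >> + v) => [|z].
    by rewrite opprD addrACA; apply: JD => //; apply: JM; rewrite -opprB rpredN.
  by rewrite [RHS]raddfD /= msumU -IHv -mcoeffU -mcoeffD.
suff v0 : v = 0 by rewrite -[u]subr0 -v0.
apply/malgP => z; rewrite ev mcoeff0.
case: (pselect (exists y, r y = z)) => [[y <-]|noy].
  by rewrite -[RHS](u0 y); apply: eq_msum => x; apply: r_eq.
by rewrite /msum big_pred0 // => y; apply/eqP => ry; apply: noy; exists y.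
Qed.

(** Lamps with zero folds along [N] are built from differences of equal lamps in one coset of [N],
    hence in one coset of [M]. *)
Lemma foldS (M N : zmodClosed B) u : {subset N <= M} ->
  (forall x, fold N u x = 0) -> forall x, fold M u x = 0.
Proof.
move=> NM; apply: (@fold_eq0_ind N (fun u => forall x, fold M u x = 0)) => [x|v
  w v0 w0 x|a y z yz x].
- exact: fold0.
- by rewrite foldB v0 w0 subrr.
- rewrite foldB /fold !msumU; apply/eqP; rewrite subr_eq0; apply/eqP;
  congr (_ *+ _).
  by rewrite -[z in LHS](subrK y) -addrA (rpredDl _ (NM _ yz)).
Qed.

(** The kernel of the fold along <b> is the image of T_b - 1: by [fold_eq0_ind] it is generated by
    differences of equal lamps whose positions differ by a multiple of [b]. *)
Lemma fold_coboundary b u : (forall x, fold (mulspan 0 b) u x = 0) <->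
  exists v, u = translate b v - v.
Proof.
split=> [|[v ->] x]; last first.
  rewrite foldB fold_translate; apply/eqP; rewrite subr_eq0; apply/eqP/fold_eq.
  by rewrite addrAC subrr add0r rpredN mulspan_gen.
apply: (fold_eq0_ind (J := fun u => exists v, u = translate b v - v)).
- by exists 0; rewrite (raddf0 (translate b)) subrr.
- move=> _ _ [v ->] [w ->]; exists (v - w).
  by rewrite translateD translateN !opprD addrACA.
- by move=> a x y; apply: coboundaryU.
Qed.

End Lamps.

(** * Conjugacy in the wreath product *)

Section Wreath.
Variables A B : zmodType.
Implicit Types (u v w : {malg A[B]}) (a : A) (b c x y z : B) (M : zmodClosed B).
Implicit Types (f g h : wreath A B).
Local Open Scope ring_scope.

Lemma wreathE f g : lamps f = lamps g -> cursor f = cursor g -> f = g.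
Proof. by case: f g => [u b] [v c] /= -> ->. Qed.

Lemma lampsM f g : lamps (f * g)%g = lamps f + translate (cursor f) (lamps g).
Proof. by []. Qed.

Lemma cursorM f g : cursor (f * g)%g = cursor f + cursor g.
Proof. by []. Qed.

Lemma lampsV f : lamps f^-1%g = translate (- cursor f) (- lamps f).
Proof. by []. Qed.

Lemma cursorV f : cursor f^-1%g = - cursor f.
Proof. by []. Qed.

(** Written so as to isolate the coboundary of [lamps h], which the fold along <cursor f> kills. *)
Lemma lamps_conj f h : lamps (f ^ h)%g =
  translate (- cursor h) (lamps f + (translate (cursor f) (lamps h) - lamps h)).
Proof.
rewrite conjgE lampsM lampsV cursorV lampsM -translateD.
by congr translate; rewrite addrC addrA.
Qed.

Lemma cursor_conj f h : cursor (f ^ h)%g = cursor f.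
Proof. by rewrite conjgE !cursorM cursorV addrC addrK. Qed.

(** Since [translate c v - u] has zero folds, it is the coboundary of some [w], and (w, c) is a
    conjugating element. *)
Lemma wreath_conj b u v c :
  (forall x, fold (mulspan 0 b) u x = fold (mulspan 0 b) v (x - c)) ->
  are_conjugate (Wreath u b) (Wreath v b).
Proof.
move=> uv; have /fold_coboundary[w ew] x : fold (mulspan 0 b) (translate c v -
  u) x = 0.
  by rewrite foldB fold_translate uv subrr.
exists (Wreath w c); apply: wreathE; rewrite ?lamps_conj ?cursor_conj //=.
by rewrite -ew addrC subrK translateA addNr translate0.
Qed.

Lemma conj_fold f g : are_conjugate f g -> cursor f = cursor g /\
  exists c, forall x, fold (mulspan 0 (cursor f)) (lamps f) x
    = fold (mulspan 0 (cursor f)) (lamps g) (x - c).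
Proof.
case=> h <-; rewrite cursor_conj; split=> //; exists (cursor h) => x.
rewrite lamps_conj fold_translate opprK subrK foldD.
have /fold_coboundary -> : exists w, translate (cursor f) (lamps h) - lamps h
  = translate (cursor f) w - w by exists (lamps h).
by rewrite addr0.
Qed.

(** The kernel of the projection from A wr B to A wr (B / M). *)
Definition fold_kernel (M : {pred B}) : set (wreath A B) :=
  [set f | cursor f \in M /\ forall x, fold M (lamps f) x = 0].

Lemma fold_kernel_normal M : normal_subgroup (fold_kernel M).
Proof.
split.
- by split=> [|x]; rewrite ?rpred0 ?fold0.
- move=> f g [fM f0] [gM g0]; split=> [|x]; first exact: rpredB.
  by rewrite lampsM lampsV foldD f0 !fold_translate foldN g0 oppr0 addr0.
- move=> f g [fM f0]; split=> [|x]; first by rewrite cursor_conj.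
  rewrite lamps_conj fold_translate foldD f0 add0r foldB fold_translate.
  by rewrite opprK; apply/eqP; rewrite subr_eq0; apply/eqP/fold_eq;
     rewrite addrAC subrr add0r rpredN.
Qed.

Lemma fold_kernel_coset M f g :
  left_coset (fold_kernel M) f = left_coset (fold_kernel M) g <->
  cursor f - cursor g \in M /\ forall x, fold M (lamps f) x = fold M (lamps g)
    x.
Proof.
have fE x : fold M (lamps (f^-1 * g)%g) x =
    fold M (lamps g) (x + cursor f) - fold M (lamps f) (x + cursor f).
  by rewrite lampsM lampsV cursorV foldD !fold_translate opprK foldN addrC.
rewrite (left_cosetP _ _ (fold_kernel_normal M)) /fold_kernel.
rewrite -[cursor f - cursor g]opprB rpredN addrC.
split=> -[fg ffg]; split=> // x.
  by apply/esym/eqP; rewrite -subr_eq0 -[x](subrK (cursor f)) -fE ffg.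
by rewrite fE ffg subrr.
Qed.

(** If [h] conjugates modulo the kernel, then [lamps (f ^ h)] and [lamps g] have the same folds
    along mB, hence along mB + <b> for [b] the cursor of [f], and there the coboundary vanishes. *)
Lemma fold_kernel_conj m f g :
  are_conjugate_mod (fold_kernel (mulspan m 0)) f g ->
  cursor f - cursor g \in mulspan m 0 /\
  exists c, forall x, fold (mulspan m (cursor f)) (lamps f) x
    = fold (mulspan m (cursor f)) (lamps g) (x - c).
Proof.
case=> h /fold_kernel_coset[]; rewrite cursor_conj => fg fold_fg; split=> //.
exists (cursor h) => x.
have {fold_fg} : forall x, fold (mulspan m (cursor f)) (lamps (f ^ h)%g - lamps
  g) x = 0.
  apply: (@foldS _ _ _ (mulspan m 0)) => [y|y]; first exact: mulspanS.
  by rewrite foldB fold_fg subrr.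
move=> /(_ (x - cursor h)) /eqP; rewrite foldB subr_eq0 => /eqP <-.
rewrite lamps_conj fold_translate opprK subrK foldD foldB fold_translate.
rewrite [fold _ _ (x - cursor f)](@fold_eq _ _ _ _ _ x) ?subrr ?addr0 //.
by rewrite addrAC subrr add0r rpredN mulspan_gen.
Qed.

(** The three conditions let [fold_sub] carry the vanishing of folds from mB + <b> to <b>. For this,
    the translation [c] given by the quotient is first replaced by a difference of points of the two
    supports. *)
Lemma fold_kernel_separates m f g : cursor f = cursor g ->
  (forall x y, x \in msupp (lamps f) -> y \in msupp (lamps f) ->
    x - y \in mulspan m (cursor f) -> x - y \in mulspan 0 (cursor f)) ->
  (forall x y, x \in msupp (lamps g) -> y \in msupp (lamps g) ->
    x - y \in mulspan m (cursor f) -> x - y \in mulspan 0 (cursor f)) ->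
  (forall x y s t, x \in msupp (lamps f) -> y \in msupp (lamps g) ->
     s \in msupp (lamps f) -> t \in msupp (lamps g) ->
    x - y - (s - t) \in mulspan m (cursor f) ->
    x - y - (s - t) \in mulspan 0 (cursor f)) ->
  are_conjugate_mod (fold_kernel (mulspan m 0)) f g -> are_conjugate f g.
Proof.
case: f g => [u b] [v _] /= <- Hu Hv Huv /fold_kernel_conj[/= _ [c uv]].
pose P := mulspan m b.
have HP : {subset mulspan 0 b <= mulspan m b} by move=> x; apply: mulspan0S.
(* If all folds of [u] vanish, so do those of [v], and the trivial translation works. *)
case: (pselect (forall x, fold P u x = 0)) => [u0|/existsNP[x0 /eqP ux0]].
  have v0 x : fold P v x = 0 by rewrite -[x](addrK c) -uv.
  apply: (@wreath_conj _ _ _ 0) => x.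
  by rewrite (fold_sub HP Hu u0) (fold_sub HP Hv v0).
have [x xu xx0] := fold_supp ux0.
have [y yv yx0] : exists2 y, y \in msupp v & y - (x0 - c) \in mulspan m b.
  by apply: fold_supp; rewrite -uv.
(* A nonzero fold at [x0] gives support points congruent to x0 and x0 - c modulo mB + <b>, so x - y
   can stand in for [c]. *)
have cxy : c - (x - y) \in mulspan m b.
  have -> : c - (x - y) = (y - (x0 - c)) - (x - x0).
    by rewrite !opprB -[RHS]addrA [c - x0 + _]addrA subrK addrCA.
  exact: rpredB.
apply: (@wreath_conj _ _ _ (x - y)) => z; apply/eqP;
  rewrite -subr_eq0 -fold_translate -foldB; apply/eqP.
move: z; apply: (fold_sub HP) => [z t|z]; last first.
  rewrite foldB fold_translate uv; apply/eqP; rewrite subr_eq0;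
    apply/eqP/fold_eq.
  by rewrite opprB addrC addrA subrK -rpredN opprB.
have supp_w r : r \in msupp (u - translate (x - y) v) ->
    r \in msupp u \/ r - (x - y) \in msupp v.
  by move=> /(fsubsetP (msuppB_le _ _));
    rewrite in_fsetU mem_msupp_translate => /orP.
have shift r r' : r - r' = r - (x - y) - (r' - (x - y)).
  by rewrite [r' - _]addrC addrKA.
move=> /supp_w[zu|zv] /supp_w[tu|tv].
- exact: Hu.
- have -> : z - t = z - (t - (x - y)) - (x - y) by rewrite -addrA -opprD subrK.
  exact: Huv.
- have -> : z - t = - (t - (z - (x - y)) - (x - y)) by rewrite -addrA -opprD
  subrK opprB.
  by rewrite !rpredN; apply: Huv.
- by rewrite shift; apply: Hv.
Qed.

End Wreath.

(** * Finite quotients *)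

Section Colouring.
Variables (A : finZmodType) (B : zmodType) (Q : finType) (rho : B -> Q).
Variable m : nat.
Implicit Types (f g : wreath A B).
Local Open Scope ring_scope.

Lemma msum_partition (P : pred B) (P' : pred Q) (u : {malg A[B]}) :
  (forall y, P y = P' (rho y)) ->
  msum P u = \sum_(q | P' q) msum (fun y => rho y == q) u.
Proof.
move=> PP; rewrite /msum (partition_big rho P') => [|y]; last by rewrite PP.
apply: eq_bigr => q Pq; apply: eq_bigl => y; rewrite PP.
by case: eqP => [->|]; rewrite ?Pq ?andbF.
Qed.

Hypothesis rho_mod : forall x y, rho x = rho y -> x - y \in mulspan m 0.

(** The colouring only has to refine the cosets of mB: the image of an element in A wr (B / mB) is
    determined by the colour of its cursor and the sum of its lamps of each colour. *)
Lemma CD_le_colouring f g :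
  ~ are_conjugate_mod (fold_kernel (mulspan m 0)) f g ->
  exists2 d, CD f g = Some d & (d <= #|A| ^ #|Q| * #|Q|)%N.
Proof.
move=> nfg.
pose tau f := ([ffun q => msum (fun y => rho y == q) (lamps f)], rho (cursor
  f)).
have [f1 f2 tau12|c cosets_c c_le] :=
    @left_cosets_card_le _ _ tau (fold_kernel (mulspan m 0)).
  case: tau12 => /ffunP lamps12 /rho_mod cursor12.
  apply/fold_kernel_coset; split=> // x.
  (* The colours that occur in x + mB; this coset is a union of colour classes. *)
  pose P q := `[< exists2 y, rho y = q & y - x \in mulspan m 0 >].
  rewrite /fold !(@msum_partition _ P) => [|y|y].
  - by apply: eq_bigr => q _; have := lamps12 q; rewrite !ffunE.
  - apply/idP/asboolP => [yx|[z /rho_mod yz zx]]; first by exists y.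
    by rewrite -[y](subrK z) -addrA rpredD // -opprB rpredN.
  - apply/idP/asboolP => [yx|[z /rho_mod yz zx]]; first by exists y.
    by rewrite -[y](subrK z) -addrA rpredD // -opprB rpredN.
have [d CDd dc] : exists2 d, CD f g = Some d & (d <= c)%N.
  apply: CD_le; apply/asboolP; exists (fold_kernel (mulspan m 0)); split=> //.
  exact: fold_kernel_normal.
by exists d => //; apply: (leq_trans dc); move: c_le;
  rewrite card_prod card_ffun.
Qed.

Lemma CD_le_cursor f g : cursor f - cursor g \notin mulspan m 0 ->
  exists2 d, CD f g = Some d & (d <= #|A| ^ #|Q| * #|Q|)%N.
Proof.
by move=> fg; apply: CD_le_colouring => /fold_kernel_conj[fg' _];
  rewrite fg' in fg.
Qed.

Lemma CD_le_lamps (D : B -> Prop) f g :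
  ~ are_conjugate f g -> cursor f = cursor g ->
  (forall x, x \in msupp (lamps f) -> D x) ->
  (forall x, x \in msupp (lamps g) -> D x) ->
  (forall x y s t, D x -> D y -> D s -> D t ->
    x - y - (s - t) \in mulspan m (cursor f) ->
    x - y - (s - t) \in mulspan 0 (cursor f)) ->
  exists2 d, CD f g = Some d & (d <= #|A| ^ #|Q| * #|Q|)%N.
Proof.
move=> nfg fg fD gD sep; apply: CD_le_colouring => /fold_kernel_separates[]//.
(* With s = t the condition on four points covers the differences within one support. *)
- move=> x y /fD Dx /fD Dy xy; rewrite -[x - y]subr0 -(subrr x);
  apply: sep => //.
  by rewrite subrr subr0.
- move=> x y /gD Dx /gD Dy xy; rewrite -[x - y]subr0 -(subrr x);
  apply: sep => //.
  by rewrite subrr subr0.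
- by move=> x y s t /fD Dx /gD Dy /fD Ds /gD Dt; apply: sep.
- by move=> h fhg; apply: nfg; exists h.
Qed.

End Colouring.

(** * Separating cyclic subgroups in a finitely generated abelian group *)

Section Generators.
Variable B : zmodType.
Implicit Types (x y g b : B) (gs : seq B) (H : zmodClosed B).
Local Open Scope ring_scope.

Definition spans gs := forall x, exists c : 'I_(size gs) -> int,
  x = \sum_(i < size gs) gs`_i *~ c i.

Lemma finitely_generated_spans :
  finitely_generated (Algebra.to_multiplicative B) -> exists gs, spans gs.
Proof.
case=> S genS; exists (S : seq B) => x; have [n] := genS x.
pose P (_ : nat) (x : B) := exists c : 'I_(size S) -> int,
  x = \sum_(i < size S) (S : seq B)`_i *~ c i.
apply: (@word_ball_ind _ S P) => {n x} [n|n x s [c xE]|//].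
  by exists (fun=> 0); rewrite big1 // => i _; rewrite mulr0z.
rewrite mem_cat => sS.
suff [d ->] : exists d : 'I_(size S) -> int, s = \sum_(i < size S) (S : seq
  B)`_i *~ d i.
  by exists (fun i => c i + d i); rewrite xE -[LHS]big_split;
    apply: eq_bigr => i _; rewrite mulrzDr.
have gen t : t \in S -> exists d : 'I_(size S) -> int, t = \sum_(i < size S) (S
  : seq B)`_i *~ d i.
  move=> tS; have it : (index t S < size S)%N by rewrite index_mem.
  exists (fun i => (i == Ordinal it)%:R).
  rewrite (bigD1 (Ordinal it)) //= eqxx mulr1z big1 ?addr0 => [|i /negPf->];
    last by rewrite mulr0z.
  by rewrite nth_index.
case/orP: sS => [/gen//|/mapP[t /gen[d ->] ->]].
exists (fun i => - d i); rewrite -[LHS]sumrN.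
by apply: eq_bigr => i _; rewrite mulrNz.
Qed.

Lemma ord_residue m : (0 < m)%N ->
  exists r : int -> 'I_m, forall a a', r a = r a' -> exists d, a - a' = d *
    m%:Z.
Proof.
case: m => // m _; exists (fun a => inord `|(a %% m.+1%:Z)%Z|).
move=> a a' /(congr1 val) /=.
have lt z : (`|(z %% m.+1%:Z)%Z| < m.+1)%N.
  by rewrite -ltz_nat gez0_abs ?modz_ge0 // ltz_pmod.
rewrite !inordK // => /(congr1 Posz); rewrite !gez0_abs ?modz_ge0 // => aa'.
exists ((a %/ m.+1%:Z)%Z - (a' %/ m.+1%:Z)%Z).
by rewrite {1}(divz_eq a m.+1%:Z) {1}(divz_eq a' m.+1%:Z) aa' opprD addrACA
  subrr addr0 mulrBl.
Qed.

(** The colour of [x] consists of the residues modulo [m] of chosen coordinates. These need not be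
    additive: congruent coordinates suffice for x - y to lie in mB. *)
Lemma spans_colouring gs m : spans gs -> (0 < m)%N ->
  exists rho : B -> {ffun 'I_(size gs) -> 'I_m},
  forall x y, rho x = rho y -> x - y \in mulspan m 0.
Proof.
move=> /choice[c cE] /ord_residue[r rP].
exists (fun x => [ffun i => r (c x i)]) => x y /ffunP rxy.
have /choice[d dE] i : exists d, c x i - c y i = d * m%:Z.
  by apply: rP; have := rxy i; rewrite !ffunE.
apply/mulspanMP; exists (\sum_(i < size gs) gs`_i *~ d i).
rewrite {1}(cE x) {1}(cE y) -sumrB -sumrMnl; apply: eq_bigr => i _.
by rewrite -mulrzBr dE mulrzA.
Qed.

Definition adjoin H g : {pred B} :=
  [pred x | `[< exists j : int, x - g *~ j \in H >] ].

Lemma adjoinP H g x :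
  reflect (exists j : int, x - g *~ j \in H) (x \in adjoin H g).
Proof. exact: asboolP. Qed.

Lemma adjoin_zmod_closed H g : zmod_closed (adjoin H g).
Proof.
split=> [|x y]; first by apply/adjoinP; exists 0; rewrite mulr0z subr0 rpred0.
move=> /adjoinP[i xi] /adjoinP[j yj]; apply/adjoinP; exists (i - j).
by rewrite mulrzBr opprD addrACA -opprD rpredB.
Qed.

HB.instance Definition _ H g :=
  GRing.isZmodClosed.Build B (adjoin H g) (adjoin_zmod_closed H g).

Lemma adjoin_sub H g : {subset H <= adjoin H g}.
Proof. by move=> x Hx; apply/adjoinP; exists 0; rewrite mulr0z subr0. Qed.

Lemma mem_adjoin H g : g \in adjoin H g.
Proof. by apply/adjoinP; exists 1; rewrite mulr1z subrr rpred0. Qed.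

(* If no positive multiple of g is in H and x is in ig + H, then i is unique and
   nonzero, so m = |i| + 1 works. *)
Lemma adjoin_multiple H g x : x \notin H ->
  exists2 m, (0 < m)%N & x \notin adjoin H (g *+ m).
Proof.
move=> xH; case: (pselect (exists2 m, (0 < m)%N & g *+ m \in H)) => [[m m0
  gm]|torf].
  exists m => //; apply/negP => /adjoinP[j]; rewrite (rpredBr x) ?(negP xH) //.
    by move=> xH'; rewrite xH' in xH.
  exact: rpredMz.
have [|xg] := boolP (x \in adjoin H g); last by exists 1%N; rewrite ?mulr1n.
move=> /adjoinP[i xi]; exists `|i|.+1%N => //; apply/negP => /adjoinP[j xj].
have gH : g *~ (i - `|i|.+1%N%:Z * j) \in H.
  rewrite mulrzBr mulrzA -pmulrn.
  have -> : g *~ i - g *+ `|i|.+1 *~ j = (x - g *+ `|i|.+1 *~ j) - (x - g *~ i).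
    by rewrite [RHS]addrC opprB addrA subrK.
  exact: rpredB.
move ed : (i - _) gH => d gH; case: d / (intP d) ed gH => [|n|n] ed gH.
- have i0 : i = 0.
    have /orP[/eqP j0|j1] : (j == 0) || (1 <= `|j|) by lia.
      by move: ed; rewrite j0 mulr0 subr0.
    have /(congr1 absz) : i = `|i|%N.+1%:Z * j by apply/eqP;
      rewrite -subr_eq0 ed.
    by rewrite abszM absz_nat; nia.
  by move: xH; rewrite i0 mulr0z subr0 in xi; rewrite xi.
- by apply: torf; exists n.+1.
- by apply: torf; exists n.+1; rewrite // -rpredN -[_ *+ _]/(_ *~ n.+1%:Z)
  -mulrNz.
Qed.

(** Multiples of the generators are adjoined to [H] one at a time while [x] stays outside; the
    product of the multipliers serves for all of them. *)
Lemma multiples_avoid gs H x : x \notin H ->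
  exists2 m, (0 < m)%N & exists M : zmodClosed B,
    [/\ {subset H <= M}, x \notin M & {in gs, forall g, g *+ m \in M}].
Proof.
elim: gs H => [|g gs IHgs] H xH; first by exists 1%N => //; exists H; split.
have [m1 m1_gt0 /IHgs[m2 m2_gt0 [M [HM xM gsM]]]] := adjoin_multiple g xH.
exists (m1 * m2)%N; first by rewrite muln_gt0 m1_gt0.
exists M; split=> // [y yH|y]; first exact/HM/adjoin_sub.
rewrite inE => /orP[/eqP->|/gsM yM]; last by rewrite mulnC mulrnA rpredMn.
by rewrite mulrnA rpredMn // HM // mem_adjoin.
Qed.

(** The subgroup [M] obtained from <b> contains m times each generator, hence mB + <b>. *)
Lemma mulspan_avoid gs b x : spans gs -> x \notin mulspan 0 b ->
  exists2 m, (0 < m)%N & x \notin mulspan m b.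
Proof.
move=> gsB /(multiples_avoid gs)[m m_gt0 [M [bM xM gsM]]]; exists m => //.
apply: contra xM => /mulspanP[y [j ->]]; apply: rpredD; last exact/bM/mulspanMz.
have [c ->] := gsB y; rewrite -sumrMnl; apply: rpred_sum => i _.
by rewrite pmulrn mulrzAC -pmulrn rpredMz // gsM // mem_nth.
Qed.

Lemma mulspan_dvd m n b x :
  (m %| n)%N -> x \in mulspan n b -> x \in mulspan m b.
Proof.
move=> /dvdnP[q ->] /mulspanP[y [j ->]]; apply/mulspanP; exists (y *+ q), j.
by rewrite mulrnA.
Qed.

(** Moduli that work for single elements are multiplied, since mB + <b> shrinks when [m] is replaced
    by a multiple. *)
Lemma mulspan_separates_seq gs b (K : seq B) : spans gs ->
  exists2 m, (0 < m)%N & {in K, forall x, x \in mulspan m b -> x \in mulspan 0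
    b}.
Proof.
move=> gsB; elim: K => [|x K [m m_gt0 Km]]; first by exists 1%N.
have [n n_gt0 xn] : exists2 n, (0 < n)%N & x \in mulspan n b -> x \in mulspan 0
  b.
  case: (boolP (x \in mulspan 0 b)) => [|/(mulspan_avoid gsB)[n n0 /negPf xn]].
    by exists 1%N.
  by exists n => //; rewrite xn.
exists (m * n)%N => [|y]; first by rewrite muln_gt0 m_gt0.
rewrite inE => /orP[/eqP-> xmn|yK ymn].
  by apply/xn/mulspan_dvd/xmn/dvdn_mull.
by apply: Km => //; apply/mulspan_dvd/ymn/dvdn_mulr.
Qed.

End Generators.

Lemma wreath_conjugacy_separable (A : finZmodType) (B : zmodType) :
  finitely_generated (Algebra.to_multiplicative B) ->
  conjugacy_separable (wreath A B).
Proof.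
move=> /finitely_generated_spans[gs gsB] f g nfg.
suff [d ->] : exists d, CD f g = Some d by [].
have [fg|/eqP fg] := cursor f =P cursor g.
  (* [E] lists both supports, and the differences of elements of [D] form the finite set K. *)
  pose E := (msupp (lamps f) ++ msupp (lamps g) : seq B).
  pose D := [seq (x - y)%R | x <- E, y <- E].
  have [m m_gt0 sep] := mulspan_separates_seq (cursor f)
    [seq (x - y)%R | x <- D, y <- D] gsB.
  have [rho rhoP] := spans_colouring gsB m_gt0.
  have [||x y s t xE yE sE tE|d -> _] := CD_le_lamps (D := fun x => x \in E)
    rhoP nfg fg.
  - by move=> x xf; rewrite mem_cat xf.
  - by move=> x xg; rewrite mem_cat xg orbT.
  - by apply: sep; apply: allpairs_f; apply: allpairs_f.
  - by exists d.
(* Different cursors are already separated in B / mB: this is the case b = 0, where <b> is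
   trivial. *)
have [|m m_gt0 fgm] := @mulspan_avoid _ gs 0 (cursor f - cursor g)%R gsB.
  by apply/negP => /mulspan0P[j]; rewrite mul0rz => /eqP;
    rewrite subr_eq0 (negPf fg).
have [rho rhoP] := spans_colouring gsB m_gt0.
by have [d -> _] := CD_le_cursor rhoP fgm; exists d.
Qed.

(** * The free part of the base group *)

Section FreePart.
Variables (B : zmodType) (k : nat) (pi : {additive B -> 'rV[int]_k}) (e : nat).
Implicit Types (x y b : B) (m : nat).
Local Open Scope ring_scope.

Lemma piM m x : pi (x *+ m) = pi x *+ m. Proof. exact: raddfMn. Qed.

Lemma rV_mulrn_eq0 n (z : 'rV[int]_n) m : (0 < m)%N -> z *+ m = 0 -> z = 0.
Proof.
move=> m0 /rowP zm; apply/rowP => i.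
have zero_i : (0 : 'rV[int]_n) 0 i = 0 by rewrite mxE.
have := zm i; rewrite mulmxnE zero_i => /eqP.
by rewrite mulrn_eq0 -leqn0 leqNgt m0 => /eqP.
Qed.

Definition free_norm x : nat := \max_i `|pi x 0%R i|%N.

Lemma free_norm_ge x i : (`|pi x 0%R i| <= free_norm x)%N.
Proof. exact: (leq_bigmax i). Qed.

Lemma free_normN x : free_norm (- x) = free_norm x.
Proof. by apply: eq_bigr => i _; rewrite raddfN mxE abszN. Qed.

Lemma free_normD x y : (free_norm (x + y) <= free_norm x + free_norm y)%N.
Proof.
apply/bigmax_leqP => i _; rewrite raddfD mxE.
have := free_norm_ge x i; have := free_norm_ge y i; lia.
Qed.

Lemma free_normB x y : (free_norm (x - y) <= free_norm x + free_norm y)%N.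
Proof. by rewrite -[in leqRHS](free_normN y); apply: free_normD. Qed.

Hypothesis e_gt0 : (0 < e)%N.
Hypothesis pi_ker : forall x, pi x = 0 -> x *+ e = 0.

(** From x = my + jb follows pi x = m pi y, whose norm is below [m], so pi y = 0. Then [y] is killed
    by [e], hence by [m], and x = jb. *)
Lemma mulspan_separates_torsion m b x : (e %| m)%N -> pi b = 0 ->
  (free_norm x < m)%N -> x \in mulspan m b -> x \in mulspan 0 b.
Proof.
move=> /dvdnP[q mE] b0 xm /mulspanP[y [j xE]].
have pix : pi x = pi y *+ m by rewrite xE raddfD raddfMz b0 mul0rz addr0 piM.
suff y0 : pi y = 0.
  by rewrite xE mE mulnC mulrnA pi_ker // mul0rn add0r mulspanMz.
apply/rowP => i; rewrite [RHS]mxE.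
have := free_norm_ge x i; rewrite pix mulmxnE -mulr_natr natz abszM absz_nat =>
  le.
have : (`|pi y 0%R i| * m < 1 * m)%N by rewrite mul1n;
  apply: leq_ltn_trans le xm.
by rewrite ltn_mul2r ltnS leqn0 absz_eq0 => /andP[_ /eqP].
Qed.

(** Write x = my + jb. For i other than i0, x_i b_i0 - x_i0 b_i is a multiple of [m] bounded by
    twice the product of the norms, hence 0, so pi x is proportional to pi b. The factor [e] in [m]
    disposes of the torsion. *)
Lemma mulspan_separates_free m b x i0 : pi b 0 i0 != 0 -> (e * `|pi b 0%R i0|%N
  %| m)%N ->
  (forall i, i = i0 \/ (free_norm x * free_norm b).*2 < m)%N ->
  x \in mulspan m b -> x \in mulspan 0 b.
Proof.
set beta := pi b 0 i0 => beta0 /dvdnP[q mE] small /mulspanP[y [j xE]].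
(* [q'] absorbs the sign of [beta]. *)
have {mE}[q' mE] : exists q', m%:Z = e%:Z * beta * q'.
  by exists (Num.sg beta * q%:Z); rewrite mE !PoszM abszE normrEsg; ring.
have pixE i : pi x 0 i = m%:Z * pi y 0 i + j * pi b 0 i.
  rewrite xE raddfD mxE raddfMz piM mulmxnE -mulr_natl natz; congr (_ + _).
  by rewrite -scaler_int mxE intz.
(* The factor dictated by the coordinate [i0], where x_i0 = j' beta. *)
pose j' := e%:Z * q' * pi y 0 i0 + j.
have pix i : pi x 0 i = j' * pi b 0 i.
  have [->|lt_m] := small i; first by rewrite pixE -/beta mE /j'; ring.
  have eq_cross : pi x 0 i * beta = pi x 0 i0 * pi b 0 i.
    have diff : pi x 0 i * beta - pi x 0 i0 * pi b 0 i =
        m%:Z * (pi y 0 i * beta - pi y 0 i0 * pi b 0 i).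
      by rewrite !pixE -/beta; ring.
    have [t0|t0] := eqVneq (pi y 0 i * beta - pi y 0 i0 * pi b 0 i) 0.
      by apply/eqP; rewrite -subr_eq0 diff t0 mulr0.
    have : (absz (pi x 0 i * beta - pi x 0 i0 * pi b 0 i)%R < m)%N.
      apply: leq_ltn_trans lt_m; rewrite -addnn.
      have := leq_mul (free_norm_ge x i) (free_norm_ge b i0).
      have := leq_mul (free_norm_ge x i0) (free_norm_ge b i).
      by rewrite -!abszM -/beta; lia.
    by rewrite diff abszM absz_nat; nia.
  by apply: (mulIf beta0); rewrite eq_cross (pixE i0) -/beta mE /j'; ring.
apply/mulspan0P; exists j'; apply/eqP; rewrite -subr_eq0; apply/eqP.
(* At this point x - j'b is only known to be torsion. It is e times [w], and [w] is torsion as well,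
   so it is 0. *)
pose w := y *~ (beta * q') - b *~ (q' * pi y 0 i0).
have xw : x - b *~ j' = w *+ e.
  rewrite xE /w /j' mulrzDr opprD addrACA subrr addr0 mulrnBl; congr (_ - _).
    by rewrite !pmulrn -mulrzA mE; congr (_ *~ _); ring.
  by rewrite pmulrn -mulrzA; congr (_ *~ _); ring.
rewrite xw pi_ker //; apply: (rV_mulrn_eq0 e_gt0); rewrite -piM -xw.
apply/rowP => i; rewrite raddfB raddfMz !mxE pix -scaler_int mxE intz.
by rewrite subrr.
Qed.

End FreePart.

Section FreeRank.
Variables (B : zmodType) (gs : seq B) (k : nat).
Local Open Scope ring_scope.
Hypothesis gsB : spans gs.

(** [e] is a product of exponents killing the torsion components of the generators, so it kills the
    torsion component of every element. *)
Lemma torsion_free_rank_proj : torsion_free_rank B k ->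
  exists (pi : {additive B -> 'rV[int]_k}) (e : nat),
    [/\ (0 < e)%N, forall x, pi x = 0 -> x *+ e = 0 & forall z, exists x, pi x
      = z].
Proof.
case=> phi [psi phiK psiK].
have free_zmod : zmod_morphism (fun x => (phi x).1) by move=> x y;
  rewrite raddfB.
have tors_zmod : zmod_morphism (fun x => (phi x).2) by move=> x y;
  rewrite raddfB.
pose free : {additive B -> 'rV[int]_k} :=
  HB.pack (fun x => (phi x).1) (GRing.isZmodMorphism.Build _ _ _ free_zmod).
pose tors : {additive B -> Tor B} :=
  HB.pack (fun x => (phi x).2) (GRing.isZmodMorphism.Build _ _ _ tors_zmod).
have [e e_gt0 tors_e] : exists2 e, (0 < e)%N & {in gs, forall g, tors g *+ e =
  0}.
  elim: (gs) => [|g s [e e0 IHs]]; first by exists 1%N.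
  have /asboolP[n n0 gn] : Tor_val (tors g) \in @torsion B by case: (tors g).
  exists (n * e)%N => [|h]; first by rewrite muln_gt0 n0.
  rewrite inE => /orP[/eqP->|/IHs hn]; last by rewrite mulnC mulrnA hn mul0rn.
  by rewrite mulrnA (_ : tors g *+ n = 0) ?mul0rn //; apply: val_inj;
    rewrite raddfMn.
exists free, e; split=> // [x x0|z]; last by exists (psi (z, 0));
  rewrite /= psiK.
have tors0 : tors (x *+ e) = 0.
  have [c ->] := gsB x; rewrite raddfMn raddf_sum -sumrMnl big1 // => i _.
  by rewrite raddfMz pmulrn mulrzAC -pmulrn tors_e ?mul0rz // mem_nth.
have free0 : free (x *+ e) = 0 by rewrite raddfMn x0 mul0rn.
rewrite -[LHS]phiK -[RHS]phiK raddf0; congr psi.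
by rewrite [LHS]surjective_pairing -[(phi _).1]/(free _) -[(phi _).2]/(tors _)
  free0 tors0.
Qed.

Variables (pi : {additive B -> 'rV[int]_k}) (e : nat).
Hypotheses (e_gt0 : (0 < e)%N) (pi_ker : forall x, pi x = 0 -> x *+ e = 0).
Hypothesis pi_surj : forall z, exists x, pi x = z.

(** The k coordinates of [pi x] are taken modulo [m], those on the generators only modulo the
    constant [e], so the number of colours grows like m^k. If x - y = ew and pi (x - y) = m pi t,
    then x - y - mt is e times an element of the kernel of [pi], hence 0. *)
Lemma free_colouring m : (e %| m)%N -> (0 < m)%N ->
  exists rho : B -> {ffun 'I_k -> 'I_m} * {ffun 'I_(size gs) -> 'I_e},
  forall x y, rho x = rho y -> x - y \in mulspan m 0.
Proof.
move=> /dvdnP[q mE] m_gt0; have [r rP] := ord_residue m_gt0.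
have [rho rhoP] := spans_colouring gsB e_gt0.
exists (fun x => ([ffun i => r (pi x 0 i)], rho x)) => x y [/ffunP rxy /rhoP].
move=> /mulspanMP[w xyw].
have /choice[z zE] i : exists d, pi x 0 i - pi y 0 i = d * m%:Z.
  by apply: rP; have := rxy i; rewrite !ffunE.
have [t tz] := pi_surj (\row_i z i).
apply/mulspanMP; exists t; apply/eqP; rewrite -subr_eq0 xyw mE mulrnA -mulrnBl.
apply/eqP; apply: pi_ker; apply: (rV_mulrn_eq0 e_gt0).
rewrite -piM mulrnBl -xyw -mulrnA -mE; apply/rowP => i.
rewrite !raddfB piM tz !mxE zE mulmxnE mxE.
by rewrite -mulr_natr natz subrr.
Qed.

End FreeRank.

(** * Word length bounds the cursor and the support *)

Section WreathNorm.
Variables (A B : zmodType) (k : nat) (pi : {additive B -> 'rV[int]_k}).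
Implicit Types (f g : wreath A B) (r : nat) (S : seq (wreath A B)).
Local Open Scope ring_scope.

Definition within r f : Prop := (free_norm pi (cursor f) <= r)%N /\
  forall x, x \in msupp (lamps f) -> (free_norm pi x <= r)%N.

Lemma within_le r r' f : (r <= r')%N -> within r f -> within r' f.
Proof.
move=> rr' [fr lr]; split; first exact: leq_trans rr'.
by move=> x /lr xr; apply: leq_trans rr'.
Qed.

Lemma withinM r r' f g : within r f -> within r' g -> within (r + r')%N (f *
  g)%g.
Proof.
move=> [fr lr] [gr lr']; split; first by rewrite cursorM;
  apply: (leq_trans (free_normD _ _ _)); apply: leq_add.
move=> x /(fsubsetP (msuppD_le _ _)); rewrite in_fsetU mem_msupp_translate.
case/orP=> [/lr|/lr' xr]; first by move/leq_trans; apply; apply: leq_addr.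
rewrite -[x](subrK (cursor f)) addrC.
by apply: (leq_trans (free_normD _ _ _)); apply: leq_add.
Qed.

(** The lamps of the inverse are shifted by the opposite of the cursor, hence the factor 2. *)
Lemma withinV r f : within r f -> within r.*2 f^-1%g.
Proof.
move=> [fr lr]; split; first by rewrite /= free_normN -addnn;
  apply: leq_trans fr _; apply: leq_addr.
move=> x; rewrite mem_msupp_translate msuppN opprK => /lr xr.
rewrite -[x](addrK (cursor f)) -addnn.
by apply: (leq_trans (free_normB _ _ _)); apply: leq_add.
Qed.

Lemma within_ex f : exists r, within r f.
Proof.
exists (free_norm pi (cursor f) + \max_(x <- msupp (lamps f)) free_norm pi x)%N.
split; first exact: leq_addr.
by move=> x xf; apply: leq_trans (leq_addl _ _); apply: leq_bigmax_seq.
Qed.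

Lemma word_ball_within S : exists2 L, (0 < L)%N &
  forall n f, f \in word_ball S n -> within (L * n) f.
Proof.
have [L SL] : exists L, {in S, forall s, within L s}.
  elim: S => [|s S [L SL]]; first by exists 0%N.
  have [r sr] := within_ex s; exists (r + L)%N => t.
  rewrite inE => /orP[/eqP->|/SL tL].
    by apply: within_le sr; apply: leq_addr.
  by apply: within_le tL; apply: leq_addl.
(* The doubling serves the inverse letters, and the successor makes the constant positive. *)
exists L.*2.+1 => //; apply: word_ball_ind => [n|n f s fn sS|n f].
- by split=> [|x]; rewrite ?msupp0 // /free_norm big1 // => i _;
  rewrite raddf0 mxE.
- rewrite mulnS addnC; apply: withinM => //.
  move: sS; rewrite mem_cat => /orP[/SL|/mapP[t /SL tL ->]].
    by apply: within_le; lia.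
  by apply: within_le (withinV tL).
- by apply: within_le; rewrite leq_mul2l leqnSn orbT.
Qed.

End WreathNorm.

(** * Upper bounds *)

Section UpperBound.
Variables (A : finZmodType) (B : zmodType) (gs : seq B) (k : nat).
Hypothesis gsB : spans gs.
Variables (pi : {additive B -> 'rV[int]_k}) (e : nat).
Hypotheses (e_gt0 : 0 < e) (pi_ker : forall x, pi x = 0%R -> (x *+ e = 0)%R).
Hypothesis pi_surj : forall z, exists x, pi x = z.
Implicit Types (b x : B) (f g : wreath A B).

(** The radius 4R is that of the differences x - y - (s - t) of points of norm at most [R]. *)
Lemma separating_modulus R M b : 0 < R -> e * (4 * R + 1) <= M ->
  k = 1 \/ e * (9 * R ^ 2) <= M -> free_norm pi b <= R ->
  exists m, [/\ 0 < m, m <= M, e %| m &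
    forall x, free_norm pi x <= 4 * R -> x \in mulspan m b -> x \in mulspan 0
      b].
Proof.
move=> R0 eM kM bR.
have [b0|/eqP/rowP/existsNP[i0 bi0]] := eqVneq (pi b) 0%R.
  exists (e * (4 * R + 1)); split=> //; [by lia|exact: dvdn_mulr|move=> x xR].
  by apply: (mulspan_separates_torsion pi_ker) => //; [apply: dvdn_mulr|nia].
have {bi0} bi0 : (pi b 0 i0 != 0)%R by apply/eqP => b0; apply: bi0;
  rewrite b0 mxE.
have bi0R : 0 < `|pi b 0%R i0| <= R.
  by rewrite lt0n absz_eq0 bi0 (leq_trans (free_norm_ge _ _ _)).
case: kM => [k1|{}eM].
  (* In rank 1, [i0] is the only coordinate, and [m] needs no lower bound. *)
  exists (e * `|pi b 0%R i0|); split; [by lia| |exact: dvdn_mulr|move=> x xR].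
    by apply: leq_trans eM; rewrite leq_mul2l; lia.
  apply: (mulspan_separates_free e_gt0 pi_ker bi0) => // i; left.
  by apply/val_inj => /=; have := ltn_ord i; have := ltn_ord i0; lia.
move: bi0R; set beta := `|pi b 0%R i0| => bi0R.
(* m / e will be the first multiple of [beta] beyond 8R^2 = 2 (4R) R; it is at most 8R^2 + R <=
   9R^2. *)
pose q := (8 * R ^ 2) %/ beta.
have q1 : q * beta <= 8 * R ^ 2 := leq_trunc_div _ _.
have q2 : 8 * R ^ 2 < q.+1 * beta by apply: ltn_ceil; case/andP: bi0R.
exists (e * beta * q.+1); split; [by nia| |by rewrite -mulnA dvdn_mulr|move=> x
  xR].
  by apply: leq_trans eM; rewrite -mulnA leq_mul2l mulnC; nia.
apply: (mulspan_separates_free e_gt0 pi_ker bi0); first exact: dvdn_mulr.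
move=> i; right; apply: (@leq_ltn_trans (8 * R ^ 2)); last by nia.
by have := leq_mul xR bR; rewrite -muln2; nia.
Qed.

Lemma CD_le_within R M f g : 0 < R -> e * (4 * R + 1) <= M ->
  k = 1 \/ e * (9 * R ^ 2) <= M ->
  within pi R f -> within pi R g -> ~ are_conjugate f g ->
  exists2 d, CD f g = Some d &
    d <= 2 ^ (#|A|.+1 * (M ^ k * e ^ size gs)).
Proof.
move=> R0 eM kM [fR lfR] [gR lgR] nfg.
have bound m d : m <= M ->
    d <= #|A| ^ #|{: {ffun 'I_k -> 'I_m} * {ffun 'I_(size gs) -> 'I_e}}|
         * #|{: {ffun 'I_k -> 'I_m} * {ffun 'I_(size gs) -> 'I_e}}| ->
    d <= 2 ^ (#|A|.+1 * (M ^ k * e ^ size gs)).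
  rewrite card_prod !card_ffun !card_ord => mM /leq_trans; apply.
  have le : m ^ k * e ^ size gs <= M ^ k * e ^ size gs.
    by rewrite leq_mul2r; apply/orP; right; case: (k) => // k';
      rewrite leq_exp2r.
  apply: leq_trans (_ : 2 ^ (#|A|.+1 * (m ^ k * e ^ size gs)) <= _); last first.
    by rewrite leq_exp2l // leq_mul2l le orbT.
  (* |A|^q q is at most 2^(|A| q) 2^q, hence the factor |A| + 1. *)
  set q := m ^ k * _; rewrite mulSn addnC expnD leq_mul //;
    last exact/ltnW/ltn_expl.
  by rewrite expnM; case: q => // n; rewrite leq_exp2r //; apply/ltnW/ltn_expl.
have [fg|/eqP fg] := cursor f =P cursor g.
  have [m [m0 mM em sep]] := separating_modulus R0 eM kM fR.
  have [rho rhoP] := free_colouring gsB e_gt0 pi_ker pi_surj em m0.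
  have [|d CDd /(bound _ _ mM) dM] :=
    CD_le_lamps (D := fun x => free_norm pi x <= R) rhoP nfg fg lfR lgR.
    move=> x y s t xR yR sR tR; apply: sep.
    have := free_normB pi (x - y) (s - t); have := free_normB pi x y.
    have := free_normB pi s t; lia.
  by exists d.
pose m := e * (4 * R + 1).
have m0 : 0 < m by rewrite /m; lia.
have [rho rhoP] := free_colouring gsB e_gt0 pi_ker pi_surj (dvdn_mulr _ (dvdnn
  e)) m0.
have [|d CDd /(bound _ _ eM) dM] := @CD_le_cursor A _ _ _ _ rhoP f g;
  last by exists d.
apply/negP => /(@mulspan_separates_torsion _ _ pi e pi_ker m 0%R).
rewrite raddf0 dvdn_mulr // => /(_ isT erefl) sep.
have /sep/mulspan0P[j] : free_norm pi (cursor f - cursor g)%R < m.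
  by apply: leq_ltn_trans (free_normB _ _ _) _; rewrite /m; nia.
by rewrite mul0rz => /eqP; rewrite subr_eq0 (negPf fg).
Qed.

End UpperBound.

(** A factor in the exponent is absorbed by rescaling the argument, as c n^j <= (cn)^j. *)
Lemma asym_le_exp (F : nat -> nat) c j : 0 < c -> 0 < j ->
  (forall n, 0 < n -> F n <= 2 ^ (c * n ^ j)) -> asym_le F (fun n => 2 ^ (n ^
    j)).
Proof.
move=> c0 j0 Fc; exists c => // n n0; apply: leq_trans (Fc n n0) _.
apply: leq_trans (leq_pmull _ c0); rewrite leq_exp2l // expnMn leq_mul2r.
by apply/orP; right; case: j j0 {Fc} => // j _;
  rewrite expnS leq_pmulr // expn_gt0 c0.
Qed.

(** Here the modulus is bounded by M = 5e(Ln), linear in [n], and M^k = M. *)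
Lemma Conj_le_rank1 (A : finZmodType) (B : zmodType) (S : seq (wreath A B)) :
  finitely_generated (Algebra.to_multiplicative B) -> torsion_free_rank B 1 ->
  asym_le (Conj S) (fun n => 2 ^ n).
Proof.
move=> /finitely_generated_spans[gs gsB] /(torsion_free_rank_proj gsB).
case=> pi [e [e0 pi_ker pi_surj]]; have [L L0 LS] := word_ball_within pi S.
pose c := #|A|.+1 * (5 * e * L * e ^ size gs).
have [|//|n n0|C C0 CS] := @asym_le_exp (Conj S) c 1.
- by rewrite /c !muln_gt0 L0 e0 expn_gt0 e0.
- apply: Conj_le => f g /LS fn /LS gn nfg.
  have R0 : 0 < L * n by rewrite muln_gt0 L0.
  have eM : e * (4 * (L * n) + 1) <= 5 * e * (L * n).
    by rewrite [5 * e]mulnC -mulnA leq_mul2l; lia.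
  have [d -> dn] := CD_le_within gsB e0 pi_ker pi_surj R0 eM (or_introl erefl)
    fn gn nfg.
  exists d => //; apply: leq_trans dn _; rewrite leq_exp2l // !expn1 /c.
  by rewrite -!mulnA leq_mul2l; apply/orP; right;
    rewrite !leq_mul2l [n * _]mulnC leqnn !orbT.
- by exists C => // n n0; have := CS n n0; rewrite expn1.
Qed.

(** Here the modulus is bounded by M = 9e(Ln)^2, and M^k produces the exponent 2k. *)
Lemma Conj_le_rank (A : finZmodType) (B : zmodType) (S : seq (wreath A B)) k :
  0 < k ->
  finitely_generated (Algebra.to_multiplicative B) -> torsion_free_rank B k ->
  asym_le (Conj S) (fun n => 2 ^ (n ^ (2 * k))).
Proof.
move=> k0 /finitely_generated_spans[gs gsB] /(torsion_free_rank_proj gsB).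
case=> pi [e [e0 pi_ker pi_surj]]; have [L L0 LS] := word_ball_within pi S.
pose c := #|A|.+1 * ((9 * e * L ^ 2) ^ k * e ^ size gs).
apply: (@asym_le_exp (Conj S) c) => [||n n0]; first 2 last.
- apply: Conj_le => f g /LS fn /LS gn nfg.
  have R0 : 0 < L * n by rewrite muln_gt0 L0.
  have eM : e * (4 * (L * n) + 1) <= e * (9 * (L * n) ^ 2) by rewrite
    leq_mul2l; nia.
  have [d -> dn] := CD_le_within gsB e0 pi_ker pi_surj R0 eM (or_intror (leqnn
    _)) fn gn nfg.
  exists d => //; apply: leq_trans dn _; rewrite leq_exp2l // /c.
  have -> : e * (9 * (L * n) ^ 2) = 9 * e * L ^ 2 * n ^ 2 by rewrite expnMn;
    lia.
  by rewrite [_ ^ k]expnMn expnM -!mulnA leq_mul2l [_ * (n ^ 2) ^ k]mulnC mulnA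
    leqnn orbT.
- by rewrite /c !(muln_gt0, expn_gt0) L0 e0.
- by rewrite muln_gt0.
Qed.

(** * The lower bound *)

Lemma prime_order_element (A : finZmodType) : 1 < #|A| ->
  exists p (a : A), [/\ prime p, a != 0%R & (a *+ p = 0)%R].
Proof.
move=> /card_gt1P[c [b [_ _ cb]]].
have {b c cb} [a a0] : exists a : A, a != 0%R.
  by case: (eqVneq c 0%R) cb => [-> b0|]; [exists b; rewrite eq_sym|exists c].
have tors : exists n, (0 < n) && (a *+ n == 0)%R.
  have /injectivePn[i [j ij aij]] : ~~ injectiveb (fun i : 'I_#|A|.+1 => (a *+
    i)%R).
    by apply/negP => /injectiveP /leq_card; rewrite card_ord ltnn.
  wlog lt_ij : i j ij aij / i < j.
    by move=> wlt; case: (ltngtP i j) ij => [/wlt|/wlt|/val_inj->];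
      rewrite ?eqxx //;
       move=> w ij; apply: w => //; rewrite eq_sym.
  exists (j - i); rewrite subn_gt0 lt_ij /= mulrnBr ?(ltnW lt_ij) //.
  by rewrite aij subrr.
case: (ex_minnP tors) => n /andP[n0 /eqP an0] n_min.
have n1 : 1 < n by case: n n0 an0 {n_min} => [|[|]] // _;
  rewrite mulr1n => /eqP; rewrite (negPf a0).
exists (pdiv n), (a *+ (n %/ pdiv n))%R; split; first exact: pdiv_prime.
  apply/negP => an; have := n_min (n %/ pdiv n).
  rewrite an divn_gt0 ?pdiv_gt0 // dvdn_leq ?pdiv_dvd // => /(_ isT).
  by rewrite leqNgt ltn_Pdiv // prime_gt1 // pdiv_prime.
by rewrite -mulrnA divnK // pdiv_dvd.
Qed.

(** * Ideals of F_p[X] containing X^(p^e) - 1 *)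

Section UnipotentIdeal.
Variables (p : nat) (p_prime : prime p).
Local Open Scope ring_scope.
Implicit Types (q W : {poly 'F_p}) (I : {poly 'F_p} -> Prop).

Lemma XsubC_exp_prime e : ('X - 1 : {poly 'F_p}) ^+ (p ^ e) = 'X ^+ (p ^ e) - 1.
Proof.
have pcharP : [pchar {poly 'F_p}]%R.-nat (p ^ e)%N.
  rewrite pnatX; apply/orP; left; apply/pnatP; first exact: prime_gt0.
  move=> r r_prime; rewrite dvdn_prime2 // => /eqP ->.
  by rewrite pchar_poly; apply: pchar_Fp.
by rewrite exprDn_pchar // exprNn_pchar // expr1n.
Qed.

Lemma sum_expX_prime e : \sum_(i < p ^ e) 'X ^+ i = ('X - 1 : {poly 'F_p}) ^+
  (p ^ e).-1.
Proof.
have X1 : 'X - 1 != 0 :> {poly 'F_p} by rewrite polyXsubC_eq0.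
apply: (mulfI X1); rewrite -subrX1 -XsubC_exp_prime -exprS prednK //.
by rewrite expn_gt0 prime_gt0.
Qed.

(** By Bezout the gcd of [W] and (X - 1)^(p^e), a power (X - 1)^s, is in [I]. It divides [W], so s <
    p^e and (X - 1)^(p^e - 1) is a multiple of it. *)
Lemma ideal_sum_expX I e W :
  (forall q1 q2, I q1 -> I q2 -> I (q1 + q2)) -> (forall q1 q2, I q2 -> I (q1 *
    q2)) ->
  I ('X ^+ (p ^ e) - 1) -> I W -> W != 0 -> (size W <= p ^ e)%N ->
  I (\sum_(i < p ^ e) 'X ^+ i).
Proof.
move=> ID IM IX IW W0 sizeW; pose Z : {poly 'F_p} := ('X - 1%:P) ^+ (p ^ e).
have IZ : I Z by rewrite /Z XsubC_exp_prime.
have [[u v] /= uvd] := Bezoutp W Z.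
have /dvdp_exp_XsubCP[s _ ds] : gcdp W Z %| Z := dvdp_gcdr _ _.
have Is : I (('X - 1%:P) ^+ s).
  have /eqpf_eq[c c0 ->] : ('X - 1%:P) ^+ s %= u * W + v * Z.
    by rewrite eqp_sym; apply: eqp_trans uvd ds.
  by rewrite -mul_polyC; apply/IM/ID; apply: IM.
have : (size (('X - 1%:P : {poly 'F_p}) ^+ s) <= size W)%N.
  by rewrite -(eqp_size ds) dvdp_leq // dvdp_gcdl.
rewrite size_exp_XsubC => /leq_trans/(_ sizeW) sm.
rewrite sum_expX_prime (_ : (p ^ e).-1 = (p ^ e).-1 - s + s)%N; last by lia.
by rewrite exprD; apply: IM.
Qed.

End UnipotentIdeal.

Section PolyLamps.
Variables (A B : zmodType) (p : nat) (a : A) (t : B).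
Hypotheses (p_prime : prime p) (a_order : (a *+ p = 0)%R).
Local Open Scope ring_scope.
Implicit Types (q : {poly 'F_p}).

Lemma mulrn_FpD (x y : 'F_p) : a *+ (x + y)%R = a *+ x + a *+ y.
Proof.
have mulrn_modp n : a *+ (n %% (Zp_trunc (pdiv p)).+2) = a *+ n.
  rewrite Fp_cast // [in RHS](divn_eq n p) mulrnDr mulnC mulrnA a_order.
  by rewrite mul0rn add0r.
by rewrite /= mulrn_modp mulrnDr.
Qed.

(** The lamps a q(X), with X^i standing for the position [t *+ i]; ['F_p] acts on [a] through
    representatives in [nat]. *)
Definition poly_lamps q : {malg A[B]} := \sum_(i < size q) << a *+ (q`_i)%R *g
  t *+ i >>.

Lemma poly_lampsE n q : (size q <= n)%N ->
  poly_lamps q = \sum_(i < n) << a *+ (q`_i)%R *g t *+ i >>.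
Proof.
move=> qn; rewrite /poly_lamps (big_ord_widen n (fun i => << a *+ (q`_i)%R *g t
  *+ i >>)) //.
rewrite big_mkcond; apply: eq_bigr => i _; case: ltnP => // qi.
by rewrite nth_default //= mulr0n monalgU0.
Qed.

Lemma poly_lampsD q1 q2 : poly_lamps (q1 + q2) = poly_lamps q1 + poly_lamps q2.
Proof.
pose n := maxn (size q1) (size q2).
rewrite (@poly_lampsE n (q1 + q2)) ?size_polyD // (@poly_lampsE n q1) ?leq_maxl
  //.
rewrite (@poly_lampsE n q2) ?leq_maxr // -big_split; apply: eq_bigr => i _ /=.
by rewrite coefD mulrn_FpD monalgUD.
Qed.

Lemma poly_lamps0 : poly_lamps 0 = 0.
Proof. by rewrite /poly_lamps size_poly0 big_ord0. Qed.

Lemma poly_lampsMX q : poly_lamps (q * 'X) = translate t (poly_lamps q).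
Proof.
rewrite (@poly_lampsE (size q).+1); last first.
  by apply: leq_trans (size_polyMleq _ _) _; rewrite size_polyX addn2.
rewrite big_ord_recl coefMX /= mulr0n monalgU0 add0r /poly_lamps raddf_sum.
by apply: eq_bigr => i _; rewrite coefMX /= translateU -mulrS.
Qed.

Lemma poly_lampsXn n : poly_lamps 'X^n = << a *g t *+ n >>.
Proof.
elim: n => [|n IHn]; last by rewrite exprSr poly_lampsMX IHn translateU -mulrS.
by rewrite expr0 /poly_lamps size_poly1 big_ord_recl big_ord0 addr0 coef1
  mulr0n.
Qed.

Lemma poly_lampsB q1 q2 : poly_lamps (q1 - q2) = poly_lamps q1 - poly_lamps q2.
Proof. by apply: (canRL (addrK _)); rewrite -poly_lampsD subrK. Qed.

Lemma poly_lamps_sum n : poly_lamps (\sum_(i < n) 'X^i) = \sum_(i < n) << a *g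
  t *+ i >>.
Proof.
elim: n => [|n IHn]; first by rewrite !big_ord0 poly_lamps0.
by rewrite !big_ord_recr poly_lampsD IHn poly_lampsXn.
Qed.

End PolyLamps.

Section LowerBound.
Variables (A B : zmodType) (a : A) (t : B).
Implicit Types (N : set (wreath A B)) (u v : {malg A[B]}) (b : B).
Local Open Scope ring_scope.

Let lamp_norm m : {malg A[B]} := \sum_(i < m) << a *g t *+ i >>.
Let f m : wreath A B := Wreath 0 (t *+ m).
Let g m : wreath A B := Wreath (lamp_norm m) (t *+ m).

(** Among 0, t, ..., (m - 1)t only 0 lies in <mt>, so the second element has fold [a] at 0, while
    all folds of the first vanish. *)
Lemma lamp_norm_nonconj m : a != 0 -> (forall n, (0 < n)%N -> t *+ n != 0) ->
  (0 < m)%N -> ~ are_conjugate (f m) (g m).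
Proof.
move=> a_neq0 t_free m0 /conj_fold[_ [c /(_ c)]];
  rewrite subrr /= fold0 => /esym /eqP.
suff -> : fold (mulspan 0 (t *+ m)) (lamp_norm m) 0 = a by rewrite (negPf
  a_neq0).
rewrite /fold /lamp_norm raddf_sum (bigD1 (Ordinal m0)) //= msumU mulr0n subrr.
rewrite rpred0 mulr1n big1 ?addr0 // => i /eqP i0; rewrite msumU subr0.
case: mulspan0P => // -[j tij].
have tz (d : int) : t *~ d = 0 -> d = 0.
  case: (intP d) => // n; rewrite ?mulrNz -?pmulrn => /eqP; rewrite ?oppr_eq0.
    by rewrite (negPf (t_free n.+1 isT)).
  by rewrite (negPf (t_free n.+1 isT)).
have /tz ijm : t *~ (i%:Z - m%:Z * j) = 0 by rewrite mulrzBr mulrzA -!pmulrn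
  tij subrr.
case: i0; apply: val_inj => /=; have := ltn_ord i.
case: j ijm {tij} => [[|j]|j] ijm; nia.
Qed.

(* (N :&: A[B]) + (T_b - 1) A[B], where T_b is the translation by b. *)
Definition lamp_subgroup N b u : Prop :=
  exists v, N (Wreath (u - (translate b v - v)) 0).

Lemma wreath_lampsD u v : (Wreath u 0 * Wreath v 0 = Wreath (u + v) 0 :> wreath
  A B)%g.
Proof. by apply: wreathE; rewrite ?lampsM ?cursorM /= ?addr0 // translate0. Qed.

Lemma wreath_lampsJ u b : (Wreath u 0 ^ Wreath 0 b = Wreath (translate (- b) u)
  0 :> wreath A B)%g.
Proof. by apply: wreathE; rewrite ?lamps_conj ?cursor_conj //= translate0 subrr
  addr0. Qed.

Lemma lamp_subgroupD N b u v : normal_subgroup N ->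
  lamp_subgroup N b u -> lamp_subgroup N b v -> lamp_subgroup N b (u + v).
Proof.
move=> nN [u' Nu] [v' Nv]; exists (u' + v').
have := normal_subgroupM nN Nu Nv; rewrite wreath_lampsD.
by rewrite translateD addrACA -opprD [_ + (translate b v' - v')]addrACA -(opprD
  u' v').
Qed.

Lemma lamp_subgroup_translate N b c u : normal_subgroup N ->
  lamp_subgroup N b u -> lamp_subgroup N b (translate c u).
Proof.
move=> nN [v Nv]; exists (translate c v);
  case: (nN) => _ _ /(_ _ (Wreath 0 (- c)) Nv).
by rewrite wreath_lampsJ opprK !raddfB /= !translateA [b + c]addrC.
Qed.

(** Conjugating (0, b) by (v, 0) yields the lamps T_b v - v. *)
Lemma lamp_subgroup_conj N b u : normal_subgroup N ->
  lamp_subgroup N b u -> are_conjugate_mod N (Wreath 0 b) (Wreath u b).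
Proof.
move=> nN [v Nv]; exists (Wreath v 0); apply/(left_cosetP _ _ nN).
case: (nN) => _ _ /(_ _ (Wreath 0 b) Nv); rewrite wreath_lampsJ.
congr N; apply: wreathE; rewrite ?cursorM ?lampsM ?cursorV ?lampsV ?cursor_conj
  ?lamps_conj /= ?addNr //.
by rewrite oppr0 translate0 add0r -translateD addrC.
Qed.

Lemma lamp_norm_separation p m d : prime p -> a *+ p = 0 -> (exists e, m = p ^
  e)%N ->
  separated_in_order (f m) (g m) d -> (p ^ m <= d)%N.
Proof.
move=> p_prime a_order [e mE] /asboolP[N [nN cosets_d nfg]].
pose J := lamp_subgroup N (t *+ m).
have J0 : J 0 by exists 0; rewrite raddf0 !subrr; case: nN.
(* [I] is an ideal: [J] is stable under translation, which gives multiplication by X. *)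
pose I (q : {poly 'F_p}) := J (poly_lamps a t q).
have ID q1 q2 : I q1 -> I q2 -> I (q1 + q2).
  by rewrite /I poly_lampsD //; apply: lamp_subgroupD.
have IX q : I q -> I (q * 'X) by rewrite /I poly_lampsMX;
  apply: lamp_subgroup_translate.
have IC (c : 'F_p) q : I q -> I (c%:P * q).
  move=> Iq; rewrite mul_polyC -[c]natr_Zp scaler_nat.
  elim: (c : nat) => [|n IHn]; first by rewrite mulr0n /I poly_lamps0.
  by rewrite mulrSr; apply: ID.
have IM q1 q2 : I q2 -> I (q1 * q2).
  move=> Iq2; elim/poly_ind: q1 => [|q c IHq];
    first by rewrite mul0r /I poly_lamps0.
  by rewrite mulrDl -mulrA ['X * _]mulrC mulrA; apply: ID;
    [exact: IX|exact: IC].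
have IXm : I ('X ^+ m - 1).
  rewrite /I poly_lampsB // -[1](expr0 'X) !poly_lampsXn mulr0n.
  (* T_mt - 1 applied to the lamp [a] at 0 is a(X^m - 1). *)
  exists << a *g 0 >>; rewrite translateU addr0 subrr; by case: nN.
(* Row vectors enumerate the polynomials of degree below [m]. *)
pose tau (F : 'rV['F_p]_m) : wreath A B := Wreath (poly_lamps a t (rVpoly F)) 0.
have <- : #|{: 'rV['F_p]_m}| = (p ^ m)%N by rewrite card_mx card_Fp // mul1n.
apply: (left_cosets_card_ge (tau := tau)) cosets_d => F1 F2 /(left_cosetP _ _
  nN) NF.
have IF : I (rVpoly F2 - rVpoly F1).
  exists 0; rewrite raddf0 !subr0 poly_lampsB // addrC.
  move: NF; congr N; apply: wreathE; rewrite ?lampsM ?cursorM ?lampsV ?cursorV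
    //= oppr0 ?addr0 //.
  by rewrite !translate0.
apply: (can_inj rVpolyK); apply/eqP; rewrite eq_sym -subr_eq0; apply/eqP.
(* A nonzero difference would put 1 + X + ... + X^(m-1) into [I] and make the two elements conjugate
   modulo [N]. *)
apply: contrapT => /eqP F12; apply: nfg; apply: lamp_subgroup_conj => //.
have := @ideal_sum_expX p p_prime I e _ ID IM _ IF F12;
  rewrite -mE /I poly_lamps_sum //; apply.
  exact: IXm.
by apply: leq_trans (size_polyD _ _) _; rewrite size_polyN geq_max !size_poly.
Qed.

End LowerBound.

(** This and the next lemma write both elements of the lower bound as m-th powers of fixed elements,
    so their word length is linear in [m]. *)
Lemma wreath_cursorX (A B : zmodType) (t : B) m :
  (Wreath 0 t ^+ m = Wreath 0 (t *+ m)%R :> wreath A B)%g.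
Proof.
elim: m => [|m IHm] //; rewrite expgS IHm.
by apply: wreathE; rewrite ?lampsM ?cursorM /= -?mulrS // add0r raddf0.
Qed.

Lemma wreath_lamp_cursorX (A B : zmodType) (a : A) (t : B) m :
  ((Wreath << a *g 0%R >> 0 * Wreath 0 t) ^+ m =
   Wreath (\sum_(i < m) << a *g t *+ i >>)%R (t *+ m)%R :> wreath A B)%g.
Proof.
elim: m => [|m IHm]; first by rewrite big_ord0.
rewrite expgS IHm; apply: wreathE; rewrite !(lampsM, cursorM) /=;
  last by rewrite add0r mulrS.
rewrite big_ord_recl mulr0n add0r raddf0 addr0; congr (_ + _)%R.
by rewrite raddf_sum; apply: eq_bigr => i _; rewrite /= translateU -mulrS.
Qed.

Lemma Conj_ge_exp (A : finZmodType) (B : zmodType) (S : seq (wreath A B)) k :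
  1 < #|A| -> finitely_generated (Algebra.to_multiplicative B) ->
  0 < k -> torsion_free_rank B k -> generating S ->
  asym_le (fun n => 2 ^ n) (Conj S).
Proof.
move=> /prime_order_element[p [a [p_prime a0 ap]]] fgB k0 rkB genS.
have [gs gsB] := finitely_generated_spans fgB.
have [pi [e [_ _ pi_surj]]] := torsion_free_rank_proj gsB rkB.
(* As k > 0, the vector with all coordinates 1 is nonzero, so [t] has infinite order. *)
have [t tE] := pi_surj (const_mx 1%R).
have t_free n : 0 < n -> (t *+ n)%R != 0%R.
  move=> n0; apply/eqP => tn; have := congr1 (fun z : 'rV_k => z 0%R (Ordinal
    k0)) (congr1 pi tn).
  by rewrite raddfMn raddf0 mulmxnE tE !mxE => /eqP; rewrite pnatr_eq0;
    case: n n0 {tn}.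
have [l1 xl] := genS (Wreath 0 t); have [l2 yl] := genS (Wreath << a *g 0%R
  >>%R 0%R).
pose l := (l2 + l1).+1; have p0 := prime_gt0 p_prime.
(* The least power m of [p] that is at least [n] satisfies m <= pn, and [l] bounds the lengths of
   the two base elements. *)
exists (p * l); first by rewrite muln_gt0 p0.
move=> n n0; pose m := p ^ up_log p n.
have nm : n <= m by apply: up_logP; rewrite // prime_gt1.
have mn : m <= p * n.
  rewrite /m; have [|n1] := leqP n 1; first by case: n n0 {nm m} => [|[|]] // _
    _; rewrite up_log1 muln_gt0 p0.
  have := up_log_gtn (prime_gt1 p_prime) n1; case: (up_log p n) => [|j] /= jn;
    first by rewrite muln_gt0 p0.
  by rewrite expnS leq_mul2l ltnW ?orbT.
have m0 : 0 < m by rewrite expn_gt0 p0.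
have ball x j : x \in word_ball S j -> j <= l -> (x ^+ m)%g \in word_ball S (p
  * l * n).
  move=> xj jl; apply: word_ball_le (word_ballX m xj).
  by rewrite mulnAC leq_mul.
have nconj := lamp_norm_nonconj a0 t_free m0.
have [d CDd] : exists d, CD (Wreath 0%R (t *+ m)%R) (Wreath (\sum_(i < m) << a
  *g t *+ i >>)%R (t *+ m)%R) = Some d.
  have := wreath_conjugacy_separable fgB nconj.
  by case: CD => // d _; exists d.
have pmd : p ^ m <= d.
  by apply: (lamp_norm_separation (t := t) p_prime ap);
    [exists (up_log p n)|apply: CD_separated].
apply: leq_trans (_ : d <= _).
  apply: leq_trans pmd; apply: leq_trans (_ : p ^ n <= _);
    last by rewrite leq_exp2l ?prime_gt1.
  by rewrite leq_exp2r // prime_gt1.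
apply: leq_trans (leq_pmull _ _); last by rewrite muln_gt0 p0.
apply: (Conj_ge _ _ nconj CDd).
  by rewrite -wreath_cursorX; apply: ball xl _; rewrite /l; lia.
by rewrite -wreath_lamp_cursorX; apply: ball (word_ballM yl xl) _.
Qed.

(** * Finite generation of the wreath product, and the theorem *)

Lemma wreath_finitely_generated (A : finZmodType) (B : zmodType) :
  finitely_generated (Algebra.to_multiplicative B) -> finitely_generated
    (wreath A B).
Proof.
case=> S genS.
pose S' : seq (wreath A B) := [seq Wreath 0%R (s : B) | s <- S] ++
  [seq Wreath << a *g 0%R >>%R 0%R | a <- enum A].
exists S'.
have gen_cursor (b : B) : exists n, Wreath 0%R b \in word_ball S' n.
  have [n bn] := genS b; exists n.
  pose P n (x : B) := Wreath 0%R x \in word_ball S' n.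
  apply: (@word_ball_ind _ S P) bn => {n b} [n|n x s xn sS|n x];
    first exact: word_ball1; last exact: word_ballS.
  rewrite /P; have -> : Wreath 0%R (x * s)%g = (Wreath 0%R (x : B) * Wreath 0%R
    (s : B))%g :> wreath A B.
    by apply: wreathE; rewrite ?lampsM ?cursorM //= add0r raddf0.
  apply: word_ball_letter => //; move: sS;
    rewrite !mem_cat => /orP[sS|/mapP[r rS ->]].
    by rewrite (map_f (fun s : B => Wreath 0%R s)).
  apply/orP; right; apply/mapP; exists (Wreath 0%R (r : B)).
    by rewrite mem_cat (map_f (fun s : B => Wreath 0%R s)).
  by apply: wreathE; rewrite ?lampsV ?cursorV //= oppr0 raddf0.
have gen_lamp (a : A) (b : B) : exists n, Wreath << a *g b >>%R 0%R \in
  word_ball S' n.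
  have [n bn] := gen_cursor b.
  exists (n + 1 + n).
  (* A lamp at [b] is a conjugate of the same lamp at 0 by a pure cursor move. *)
  have -> : Wreath << a *g b >>%R 0%R =
      (Wreath 0%R b * Wreath << a *g 0%R >>%R 0%R * (Wreath 0%R b)^-1)%g :>
        wreath A B.
    apply: wreathE; rewrite !(lampsM, cursorM, lampsV, cursorV) /=;
      last by rewrite addr0 subrr.
    by rewrite add0r translateU addr0 oppr0 !raddf0 addr0.
  apply: word_ballM (word_ballV bn); apply: word_ballM bn (word_ball_mem _).
  by rewrite mem_cat; apply/orP; right; apply: map_f; rewrite mem_enum.
have gen_lamps (u : {malg A[B]}) : exists n, Wreath u 0%R \in word_ball S' n.
  elim/malg_ind: u => [|a x u [n un]]; first by exists 0; rewrite /= inE.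
  have [n' xn'] := gen_lamp a x; exists (n' + n).
  by rewrite -wreath_lampsD word_ballM.
case=> u b; have [n un] := gen_lamps u; have [n' bn'] := gen_cursor b.
exists (n + n'); have -> : Wreath u b = (Wreath u 0%R * Wreath 0%R b)%g.
  by apply: wreathE; rewrite !(lampsM, cursorM) /= ?add0r // raddf0 addr0.
exact: word_ballM.
Qed.

Theorem theorem1p1 (A : finZmodType) (B : zmodType) :
  1 < #|A| ->
  finitely_generated (Algebra.to_multiplicative B) ->
  infinite_set [set: B]%classic ->
  let G : groupType := wreath A B in
  [/\ finitely_generated G,
      conjugacy_separable G,
      torsion_free_rank B 1 ->
        forall S : seq G, generating S ->
          asym_eq (Conj S) (fun n => 2 ^ n)
    & forall k, 2 <= k -> torsion_free_rank B k ->
        forall S : seq G, generating S ->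
          asym_le (fun n => 2 ^ n) (Conj S) /\
          asym_le (Conj S) (fun n => 2 ^ (n ^ (2 * k)))].
Proof.
move=> A1 fgB _ G; split.
- exact: wreath_finitely_generated.
- exact: wreath_conjugacy_separable.
- move=> rkB S genS; split; first exact: Conj_le_rank1.
  by apply: (Conj_ge_exp (k := 1)).
- move=> k k2 rkB S genS; have k0 : 0 < k by apply: ltnW.
  by split; [apply: (Conj_ge_exp (k := k))|apply: Conj_le_rank].
Qed.
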